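(* Let $K$ be a number field, let $C$ be a hyperelliptic curve over $K$ given by an equation $y^2=h(x)$ with $h\in K[x]$, let $\sigma$ be its hyperelliptic involution, and let $\tau$ be the involution $\tau(z)=-z$ of $\mathbb{P}^1_K$. Let $X$ be either the quotient of $C\times\mathbb{P}^1$ by the involution $(\sigma,\tau)$, or the quotient of $C\times\mathbb{P}^1\times\mathbb{P}^1$ by the involution $(\sigma,\tau,\tau)$. Then $X$ satisfies weak approximation.
   Context: A hyperelliptic curve given by $y^2=h(x)$ is the smooth projective curve of genus $g\geq 2$ with this affine equation, where $h$ is separable; its hyperelliptic involution is $(x,y)\mapsto(x,-y)$. Let $\Omega$ be the set of places of the number field $K$ and, for $\nu\in\Omega$, let $K_\nu$ be the completion of $K$ at $\nu$. For a variety $X$ over $K$, the set $X(K_\nu)$ carries its analytic ($\nu$-adic) topology. $X$ satisfies weak approximation if $X(K)$ is dense in $\prod_{\nu\in\Omega}X(K_\nu)$ equipped with the product topology. *)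

(* Defs.v *)
From HB Require Import structures.
From mathcomp Require Import all_boot all_order all_algebra all_field.
From mathcomp Require Import boolp classical_sets reals topology.
From mathcomp Require Import mpoly.

Set Implicit Arguments.
Unset Strict Implicit.
Unset Printing Implicit Defensive.

Import Order.TTheory GRing.Theory Num.Theory.
Local Open Scope classical_set_scope.
Local Open Scope ring_scope.

Section AbsoluteValues.
Variable R : realType.

Record is_absval (K : fieldType) (v : K -> R) : Prop := IsAbsval {
  absval_ge0 : forall x, 0 <= v x;
  absval_eq0 : forall x, v x = 0 <-> x = 0;
  absvalM : forall x y, v (x * y) = v x * v y;
  absvalD : forall x y, v (x + y) <= v x + v y }.

Definition nontrivial_absval (K : fieldType) (v : K -> R) : Prop :=
  exists2 x, x != 0 & v x != 1.

Definition absval_open (K : fieldType) (v : K -> R) (U : set K) : Prop :=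
  forall x, U x -> exists2 e, 0 < e & forall y, v (y - x) < e -> U y.

Definition same_topology (K : fieldType) (v w : K -> R) : Prop :=
  forall U, absval_open v U <-> absval_open w U.

Definition is_place (K : fieldType) (P : set (K -> R)) : Prop :=
  exists v, [/\ is_absval v, nontrivial_absval v &
    P = [set w | is_absval w /\ same_topology v w]].

(* The set Omega of places: equivalence classes of nontrivial absolute values,
   archimedean ones included. *)
Definition place (K : fieldType) : Type := {P : set (K -> R) | is_place P}.

Record completion (K : fieldType) (v : place K) := Completion {
  completion_field :> fieldType;
  completion_abs : completion_field -> R;
  completion_emb : {rmorphism K -> completion_field};
  completion_absP : is_absval completion_abs;
  completion_place : sval v (completion_abs \o completion_emb);
  completion_dense : forall x e, 0 < e ->
    exists a, completion_abs (completion_emb a - x) < e;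
  completion_complete : forall u : nat -> completion_field,
    (forall e, 0 < e -> exists N, forall m n, (N <= m)%N -> (N <= n)%N ->
       completion_abs (u m - u n) < e) ->
    exists l, forall e, 0 < e -> exists N, forall n, (N <= n)%N ->
       completion_abs (u n - l) < e }.

End AbsoluteValues.

(* An integral separated K-variety is given by its function field together
   with the coordinate rings, inside that field, of the members of an affine
   open cover.  [rat_fun] may be larger than the function field, so that a
   quotient variety can keep the ambient field of the variety it comes from:
   only fractions of elements of the charts are used below.  No inverses are
   taken in [rat_fun], so it is only required to be a commutative ring. *)
Record variety (K : fieldType) := Variety {
  rat_fun : comNzRingType;
  rat_cst : {rmorphism K -> rat_fun};
  chart_index : Type;
  chart : chart_index -> set rat_fun }.

(* Quotient by the cyclic group generated by s, for a cover by s-stable affine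
   open sets Spec A: it is covered by the Spec of the rings of invariants. *)
Definition quotient (K : fieldType) (X : variety K)
    (s : {rmorphism rat_fun X -> rat_fun X}) : variety K :=
  @Variety K (rat_fun X) (rat_cst X) (chart_index X)
    (fun i => [set f | chart i f /\ s f = f]).

Section Points.
Variables (K : fieldType) (X : variety K) (L : fieldType).
Variable iota : {rmorphism K -> L}.

Definition alg_hom_on (A : set (rat_fun X)) (phi : rat_fun X -> L) : Prop :=
  (forall c, phi (rat_cst X c) = iota c) /\
  (forall a b, A a -> A b ->
     phi (a + b) = phi a + phi b /\ phi (a * b) = phi a * phi b).

(* An L-point of X is an L-point phi : A -> L of some chart Spec A.  It is
   recorded by the evaluation P it induces on rational functions: P f = Some c
   when f is regular at the point, i.e. f = a / b with a, b in A and
   phi b != 0, and has the value c = phi a / phi b there.  As X is separated,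
   points of two charts are glued together exactly when they induce the same
   evaluation of rational functions. *)
Definition is_point (P : rat_fun X -> option L) : Prop :=
  exists (i : chart_index X) (phi : rat_fun X -> L),
    alg_hom_on (chart i) phi /\
    forall f c, P f = Some c <->
      exists a b, [/\ chart i a, chart i b, phi b != 0, b * f = a
                    & c = phi a / phi b].

Definition point : Type := {P : rat_fun X -> option L | is_point P}.

End Points.

Section LocalPoints.
Variables (R : realType) (K : fieldType) (X : variety K).
Variables (v : place R K) (Kv : completion v).

Definition local_point : Type := point X (completion_emb Kv).

HB.instance Definition _ := gen_eqMixin local_point.
HB.instance Definition _ := gen_choiceMixin local_point.

(* The analytic topology: the coarsest one for which every rational function
   has an open domain of regularity, and is continuous on it. *)
Definition analytic_subbase : set (set local_point) :=
  [set U | exists f (W : set Kv), absval_open (@completion_abs _ _ _ Kv) W /\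
     U = [set P | exists2 c, sval P f = Some c & W c]].

HB.instance Definition _ :=
  isSubBaseTopological.Build local_point analytic_subbase id.

End LocalPoints.

Section WeakApproximation.
Variables (R : realType) (K : fieldType) (X : variety K).
Variable Kv : forall v : place R K, completion v.

Definition product_of_local_points : topologicalType :=
  prod_topology (fun v => local_point X (Kv v)).

Definition diagonal_image : set product_of_local_points :=
  [set P | exists Q : point X (@idfun K),
     forall v f, sval (P v) f = omap (completion_emb (Kv v)) (sval Q f)].

End WeakApproximation.

(* The completions are unique up to isomorphism. *)
Definition weak_approximation (R : realType) (K : fieldType)
    (X : variety K) : Prop :=
  forall Kv : (forall v : place R K, completion v),
    dense (@diagonal_image R K X Kv).

Section FractionMap.
Variables (A B : idomainType) (f : {rmorphism A -> B}).

Definition frac_map (q : {fraction A}) : {fraction B} :=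
  FracField.tofrac (f \n_(repr q)) / FracField.tofrac (f \d_(repr q)).

Hypothesis f_inj : injective f.

Let fneq0 a : a != 0 -> FracField.tofrac (f a) != 0.
Proof. by move=> a0; rewrite tofrac_eq0 -(rmorph0 f) (inj_eq f_inj). Qed.

Lemma frac_numden (q : {fraction A}) :
  q * FracField.tofrac \d_(repr q) = FracField.tofrac \n_(repr q).
Proof.
rewrite -{1}[q]reprK; unlock FracField.tofrac; rewrite -[LHS]FracField.pi_mul.
apply/eqmodP; rewrite /= FracField.equivfE /FracField.mulf /=.
by rewrite !numden_Ratio ?oner_neq0 ?mulr1 ?mul1r ?denom_ratioP // mulrC.
Qed.

Lemma frac_mapE (q : {fraction A}) a b : b != 0 ->
  q * FracField.tofrac b = FracField.tofrac a ->
  frac_map q = FracField.tofrac (f a) / FracField.tofrac (f b).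
Proof.
move=> b0 qba; rewrite /frac_map.
have d0 := denom_ratioP (repr q).
have e : \n_(repr q) * b = a * \d_(repr q).
  by apply/eqP; rewrite -tofrac_eq !tofracM -qba -frac_numden mulrAC.
by apply/eqP; rewrite eqr_div ?fneq0 // -!tofracM -!rmorphM e.
Qed.

Lemma frac_map_tofrac a :
  frac_map (FracField.tofrac a) = FracField.tofrac (f a).
Proof.
by rewrite (@frac_mapE _ a 1) ?oner_neq0 ?rmorph1 ?mulr1 ?divr1.
Qed.

Fact frac_map_is_zmod_morphism : zmod_morphism frac_map.
Proof.
move=> p q; have dp := denom_ratioP (repr p); have dq := denom_ratioP (repr q).
set np := \n_(repr p); set nq := \n_(repr q).
rewrite (@frac_mapE _ (np * \d_(repr q) - nq * \d_(repr p))
           (\d_(repr p) * \d_(repr q))) ?mulf_neq0 //; last first.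
  rewrite rmorphB !rmorphM /= -!frac_numden mulrBl.
  by congr (_ - _); rewrite ?mulrA // [in RHS]mulrAC.
rewrite /frac_map -/np -/nq -[in RHS]mulNr addf_div ?fneq0 //.
by rewrite mulNr -!tofracM -tofracB -!rmorphM -rmorphB.
Qed.

Fact frac_map_is_monoid_morphism : monoid_morphism frac_map.
Proof.
split=> [|p q]; first by rewrite -tofrac1 frac_map_tofrac rmorph1.
rewrite (@frac_mapE _ (\n_(repr p) * \n_(repr q))
           (\d_(repr p) * \d_(repr q))) ?mulf_neq0 ?denom_ratioP //.
  by rewrite /frac_map !rmorphM /= mulf_div.
by rewrite !rmorphM /= -!frac_numden mulrACA.
Qed.

End FractionMap.

Section Curve.
Variables (K : fieldType) (h : {poly K}) (n : nat).

(* Coordinates on the product of the x-line and n projective lines: the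
   variable 0 is x and the variable i + 1 is the coordinate z_i. *)
Local Notation D := {mpoly K[n.+1]}.
Local Notation E := {fraction D}.

Definition coordinate (i : 'I_n.+1) : E := FracField.tofrac 'X_i.

Definition coord_cst : {rmorphism K -> E} :=
  (@FracField.tofrac D \o @mpolyC n.+1 K)%FUN.

Definition curve_eqn : {poly E} :=
  'X^2 - ((map_poly coord_cst h).[coordinate ord0])%:P.

(* K(x, z_1, ..., z_n)[y] / (y^2 - h(x)), which is a field when h is separable
   and nonconstant. *)
Definition fun_ring : comNzRingType := {poly %/ curve_eqn}.

Definition fun_emb : {rmorphism E -> fun_ring} := qpolyC curve_eqn.

Definition fun_cst : {rmorphism K -> fun_ring} := (fun_emb \o coord_cst)%FUN.

Definition fun_y : fun_ring := in_qpoly curve_eqn 'X.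

(* With 2g + 1 or 2g + 2 for the degree of h, this is g + 1. *)
Definition genus_succ : nat := (size h)./2.

(* The product of the smooth projective model of y^2 = h(x), covered by the
   affine curves with coordinates (x, y) and (1/x, y/x^(g+1)), with n projective
   lines, each covered by the affine lines with coordinates z_i and 1/z_i. *)
Definition curve_gens (b : bool) : set fun_ring :=
  if b then [set fun_emb (coordinate ord0)^-1;
                 fun_y * fun_emb (coordinate ord0 ^- genus_succ)]
  else [set fun_emb (coordinate ord0); fun_y].

Definition line_gen (i : 'I_n) (b : bool) : fun_ring :=
  let z := coordinate (lift ord0 i) in fun_emb (if b then z^-1 else z).

Definition is_subalg (A : set fun_ring) : Prop :=
  (forall c, A (fun_cst c)) /\
  (forall a b, A a -> A b -> A (a + b) /\ A (a * b)).

Definition curve_times_lines : variety K :=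
  @Variety K fun_ring fun_cst (bool * {ffun 'I_n -> bool})%type
    (fun i => smallest is_subalg
       (curve_gens i.1 `|` [set line_gen j (i.2 j) | j in setT])).

(* fun_inv below is the pullback of functions along (sigma, tau, ..., tau): it
   fixes x and changes the sign of y and of all the z_i. *)

Definition coord_sign : n.+1.-tuple D :=
  [tuple if i == ord0 then 'X_i else - 'X_i | i < n.+1].

Definition coord_inv : {rmorphism D -> D} := comp_mpoly coord_sign.

Fact coord_invK : involutive coord_inv.
Proof.
have invX i : coord_inv 'X_i = if i == ord0 then 'X_i else - 'X_i.
  by rewrite /= comp_mpolyXU -tnth_nth tnth_mktuple.
move=> p; elim/mpolyind: p => [|c m p _ _ IH]; first by rewrite !rmorph0.
rewrite !rmorphD /= IH !comp_mpolyZ; congr (_ *: _ + _).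
rewrite mpolyXE_id !rmorph_prod /=; apply: eq_bigr => i _.
rewrite !rmorphXn /= -!/(coord_inv _) invX; congr (_ ^+ _).
by case: eqP => i0; rewrite ?rmorphN /= -/(coord_inv _) invX
  ?(introT eqP i0) ?(introF eqP i0) ?opprK.
Qed.

Definition base_inv : E -> E := frac_map coord_inv.

HB.instance Definition _ := GRing.isZmodMorphism.Build E E base_inv
  (frac_map_is_zmod_morphism (inv_inj coord_invK)).
HB.instance Definition _ := GRing.isMonoidMorphism.Build E E base_inv
  (frac_map_is_monoid_morphism (inv_inj coord_invK)).

Definition poly_inv (p : {poly E}) : fun_ring :=
  in_qpoly curve_eqn (map_poly base_inv p \Po - 'X).

Definition fun_inv_def (f : fun_ring) : fun_ring := poly_inv (val f).

Fact base_inv_coord i :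
  base_inv (coordinate i) = if i == ord0 then coordinate i else - coordinate i.
Proof.
rewrite /base_inv /coordinate frac_map_tofrac; last exact: inv_inj coord_invK.
rewrite /= comp_mpolyXU -tnth_nth tnth_mktuple.
by case: ifP => // _; rewrite rmorphN.
Qed.

Fact base_inv_cst c : base_inv (coord_cst c) = coord_cst c.
Proof.
rewrite /base_inv /coord_cst /= frac_map_tofrac; last exact: inv_inj coord_invK.
by rewrite /= comp_mpolyC.
Qed.

Fact mk_monic_curve_eqn : mk_monic curve_eqn = curve_eqn.
Proof.
rewrite /mk_monic /curve_eqn -polyCN.
set c := - _; have sX : (size c%:P < size ('X^2 : {poly E}))%N.
  by rewrite size_polyXn (leq_ltn_trans (size_polyC_leq1 _)).
by rewrite size_polyDl // size_polyXn monicE lead_coefDl // lead_coefXn eqxx.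
Qed.

Fact poly_inv_is_zmod_morphism : zmod_morphism poly_inv.
Proof. by move=> p q; rewrite /poly_inv !rmorphB. Qed.

Fact poly_inv_is_monoid_morphism : monoid_morphism poly_inv.
Proof. by split=> [|p q]; rewrite /poly_inv ?rmorph1 ?rmorphM. Qed.

HB.instance Definition _ := GRing.isZmodMorphism.Build {poly E} fun_ring
  poly_inv poly_inv_is_zmod_morphism.
HB.instance Definition _ := GRing.isMonoidMorphism.Build {poly E} fun_ring
  poly_inv poly_inv_is_monoid_morphism.

Fact poly_inv_eqn : poly_inv curve_eqn = 0.
Proof.
have e : map_poly base_inv curve_eqn \Po - 'X = curve_eqn.
  rewrite /curve_eqn rmorphB /= map_polyXn map_polyC /= comp_polyB comp_polyC.
  rewrite rmorphXn /= comp_polyX sqrrN; congr (_ - _%:P).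
  rewrite -horner_map /= base_inv_coord eqxx -map_poly_comp.
  congr (_.[_]); apply: eq_map_poly => c; exact: base_inv_cst.
rewrite /poly_inv e; apply: val_inj.
rewrite /= mk_monic_curve_eqn Pdiv.RingMonic.rmodpp //.
by rewrite -mk_monic_curve_eqn monic_mk_monic.
Qed.

Fact fun_inv_in_qpoly p : fun_inv_def (in_qpoly curve_eqn p) = poly_inv p.
Proof.
rewrite /fun_inv_def /= mk_monic_curve_eqn.
have mon : curve_eqn \is monic by rewrite -mk_monic_curve_eqn monic_mk_monic.
by rewrite {2}(Pdiv.RingMonic.rdivp_eq mon p) rmorphD rmorphM /= poly_inv_eqn mulr0 add0r.
Qed.

Fact fun_inv_is_zmod_morphism : zmod_morphism fun_inv_def.
Proof. by move=> f g; rewrite /fun_inv_def /= rmorphB. Qed.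

Fact fun_inv_is_monoid_morphism : monoid_morphism fun_inv_def.
Proof.
split=> [|f g]; last by rewrite fun_inv_in_qpoly rmorphM.
rewrite -[X in fun_inv_def X = _](rmorph1 (in_qpoly curve_eqn)).
by rewrite fun_inv_in_qpoly rmorph1.
Qed.

HB.instance Definition _ := GRing.isZmodMorphism.Build fun_ring fun_ring
  fun_inv_def fun_inv_is_zmod_morphism.
HB.instance Definition _ := GRing.isMonoidMorphism.Build fun_ring fun_ring
  fun_inv_def fun_inv_is_monoid_morphism.

Definition fun_inv : {rmorphism fun_ring -> fun_ring} := fun_inv_def.

Fact fun_inv_emb e : fun_inv (fun_emb e) = fun_emb (base_inv e).
Proof.
rewrite /fun_inv /fun_emb /= /fun_inv_def /= /poly_inv map_polyC comp_polyC.
apply: val_inj; rewrite /= Pdiv.Ring.rmodp_small //.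
by rewrite (leq_ltn_trans (size_polyC_leq1 _)) // size_mk_monic_gt1.
Qed.

Lemma fun_inv_cst c : fun_inv (fun_cst c) = fun_cst c.
Proof. by rewrite [LHS]fun_inv_emb base_inv_cst. Qed.

Lemma fun_inv_x : fun_inv (fun_emb (coordinate ord0)) = fun_emb (coordinate ord0).
Proof. by rewrite fun_inv_emb base_inv_coord eqxx. Qed.

Lemma fun_inv_y : fun_inv fun_y = - fun_y.
Proof.
rewrite /fun_inv /= fun_inv_in_qpoly /poly_inv map_polyX comp_polyX.
exact: rmorphN.
Qed.

Lemma fun_inv_z i :
  fun_inv (fun_emb (coordinate (lift ord0 i))) = - fun_emb (coordinate (lift ord0 i)).
Proof. by rewrite fun_inv_emb base_inv_coord /= rmorphN. Qed.

End Curve.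

(* Main.v *)
(** Writing s_j = z_j / y, the function field of the quotient is the rational
    function field K(x, s_1, ..., s_n): at parameters (x, s) with d = h(x), the
    invariant functions are evaluated by y = T, z_j = s_j T in K[T]/(T^2 - d),
    where they take values in K.  So K-points are plentiful, and by the
    Artin-Whaples approximation theorem they can be prescribed near finitely
    many local parameters.

    The quotient is singular where y and the odd coordinates vanish together,
    so local points need not have parameters.  A local point of a chart is given
    by the base coordinate X0 and the matrix Q of values of the products
    w_a w_b of odd coordinates, which has rank at most one: Q = d f f^T.  When
    f_0 = 0, X0 is a simple root of the chart equation p, say with
    p = r (X - X0), and the points with w_0 = eps and base coordinate
    X0 + (d / r(X0)) eps^2 have matrices d' e e^T with e near f and
    d' = p(X) / eps^2 -> d as eps -> 0.  These do have parameters. *)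
Require Import Defs.
From mathcomp Require Import all_boot all_order all_algebra all_field.
From mathcomp Require Import boolp classical_sets reals topology.
From mathcomp Require Import mpoly ring lra zify.

Set Implicit Arguments.
Unset Strict Implicit.
Unset Printing Implicit Defensive.

Import Order.TTheory GRing.Theory Num.Theory.
Local Open Scope classical_set_scope.
Local Open Scope ring_scope.

(** * Absolute values and the Artin-Whaples theorem *)

Lemma bernoulli_ineq (R : realFieldType) (t : R) k :
  0 <= t -> t *+ k + 1 <= (t + 1) ^+ k.
Proof.
move=> t0; elim: k => [|k IH]; first by rewrite mulr0n add0r expr0.
have y1 : 1 <= (t + 1) ^+ k by rewrite exprn_ege1 // lerDr.
have : t <= t * (t + 1) ^+ k by rewrite ler_peMr.
by rewrite exprS mulrSr; move: (t *+ k) (_ ^+ k) IH y1 => u y; lra.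
Qed.

Section AbsvalTheory.
Variables (R : realType) (L : fieldType) (w : L -> R).
Hypothesis wP : is_absval w.

Lemma absval0 : w 0 = 0.
Proof. exact/(absval_eq0 wP). Qed.

Lemma absval_neq0 x : x != 0 -> w x != 0.
Proof. by apply: contra_neq => /(absval_eq0 wP). Qed.

Lemma absval_gt0 x : x != 0 -> 0 < w x.
Proof. by move=> x0; rewrite lt_neqAle eq_sym absval_neq0 // absval_ge0. Qed.

Lemma absval1 : w 1 = 1.
Proof.
apply: (mulfI (absval_neq0 (oner_neq0 L))).
by rewrite -absvalM // !mulr1.
Qed.

Lemma absvalX x k : w (x ^+ k) = w x ^+ k.
Proof.
by elim: k => [|k IH]; rewrite ?expr0 ?absval1 // !exprS absvalM // IH.
Qed.

Lemma absvalN x : w (- x) = w x.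
Proof.
have wN1 : w (- 1) = 1.
  by apply/eqP; rewrite -(@pexpr_eq1 _ _ 2) ?absval_ge0 // -absvalX sqrrN expr1n absval1.
by rewrite -mulN1r absvalM // wN1 mul1r.
Qed.

Lemma absvalV x : w x^-1 = (w x)^-1.
Proof.
have [->|x0] := eqVneq x 0; first by rewrite !invr0 absval0 invr0.
by apply: (mulfI (absval_neq0 x0)); rewrite -absvalM // !divff ?absval1 ?absval_neq0.
Qed.

Lemma absval_distC x y : w (x - y) = w (y - x).
Proof. by rewrite -absvalN opprB. Qed.

Lemma absval_ler_sub x y : w x - w (y - x) <= w y.
Proof.
rewrite lerBlDr absval_distC (le_trans _ (absvalD wP _ _)) //.
by rewrite addrCA subrr addr0.
Qed.

(** Convergence in absolute value along an arbitrary filter: one limit calculus then serves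
    sequences, homomorphisms, punctured neighbourhoods and parameters. *)
Definition abs_cvg (T : Type) (F : set_system T) (f : T -> L) (l : L) : Prop :=
  forall e, 0 < e -> F [set t | w (f t - l) < e].

Section Convergence.
Variables (T : Type) (F : set_system T).
Hypothesis FF : Filter F.
Implicit Types f g : T -> L.

Lemma abs_cvg_near f g l :
  F [set t | f t = g t] -> abs_cvg F f l -> abs_cvg F g l.
Proof.
by move=> fg fl e e0; apply: filterS (filterI fg (fl e e0)) => t [/= ->].
Qed.

Lemma abs_cvg_ext f g l : (forall t, f t = g t) -> abs_cvg F f l -> abs_cvg F g l.
Proof. by move=> fg; apply: abs_cvg_near; apply: filterE. Qed.

Lemma abs_cvg_cst l : abs_cvg F (fun=> l) l.
Proof. by move=> e e0; apply: filterE => t; rewrite /= subrr absval0. Qed.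

Lemma abs_cvgD f g l m : abs_cvg F f l -> abs_cvg F g m ->
  abs_cvg F (fun t => f t + g t) (l + m).
Proof.
move=> fl gm e e0; have e20 : 0 < e / 2 by rewrite divr_gt0.
apply: filterS (filterI (fl _ e20) (gm _ e20)) => t [/= ft gt].
by rewrite opprD addrACA (le_lt_trans (absvalD wP _ _)) // (splitr e) ltrD.
Qed.

Lemma abs_cvgM f g l m : abs_cvg F f l -> abs_cvg F g m ->
  abs_cvg F (fun t => f t * g t) (l * m).
Proof.
move=> fl gm e e0.
have l0 := absval_ge0 wP l; have m0 := absval_ge0 wP m.
set s := 1 + w l + w m; have s0 : 0 < s by rewrite /s; lra.
pose d := Num.min 1 (e / s).
have d0 : 0 < d by rewrite lt_min ltr01 divr_gt0.
have d1 : d <= 1 by rewrite ge_min lexx.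
have ds : d * s <= e by rewrite -ler_pdivlMr // ge_min lexx orbT.
apply: filterS (filterI (fl _ d0) (gm _ d0)) => t [/= ft gt].
have -> : f t * g t - l * m = (f t - l) * ((g t - m) + m) + l * (g t - m) by ring.
apply: le_lt_trans (absvalD wP _ _) _; rewrite !(absvalM wP).
have a0 := absval_ge0 wP (f t - l); have b0 := absval_ge0 wP (g t - m).
have := absvalD wP (g t - m) m; move: (w (_ + m)) => c hc.
apply: lt_le_trans ds; rewrite /s.
have : w (f t - l) * c <= w (f t - l) * (1 + w m).
  by apply: ler_wpM2l => //; lra.
have : w (f t - l) * (1 + w m) < d * (1 + w m) by rewrite ltr_pM2r //; lra.
have : w l * w (g t - m) <= w l * d by apply: ler_wpM2l => //; exact: ltW.
by lra.
Qed.

Lemma abs_cvg_neq0 f l : l != 0 -> abs_cvg F f l -> F [set t | f t != 0].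
Proof.
move=> l0 fl; apply: filterS (fl _ (absval_gt0 l0)) => t /=.
by apply: contraTneq => ->; rewrite sub0r absvalN ltxx.
Qed.

Lemma abs_cvgV f l : l != 0 -> abs_cvg F f l ->
  abs_cvg F (fun t => (f t)^-1) l^-1.
Proof.
move=> l0 fl e e0; have wl0 := absval_gt0 l0.
(* The first bound keeps [w (f t)] above [w l / 2], so that dividing by [w (f t * l)] costs at most
   the factor 2 / (w l)^2 of the second bound. *)
pose d := Num.min (w l / 2) (e * (w l ^+ 2 / 2)).
have d0 : 0 < d by rewrite lt_min divr_gt0 //= mulr_gt0 // divr_gt0 // exprn_gt0.
apply: filterS (filterI (abs_cvg_neq0 l0 fl) (fl _ d0)) => t [/= ft0].
rewrite lt_min => /andP[h1 h2].
have -> : (f t)^-1 - l^-1 = (l - f t) / (f t * l) by field; rewrite l0 ft0.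
rewrite absvalM // absvalV absvalM // absval_distC.
have := absval_ler_sub l (f t) => h3.
have wf0 := absval_gt0 ft0.
rewrite ltr_pdivrMr ?mulr_gt0 //; apply: lt_le_trans h2 _.
rewrite ler_pM2l // expr2 mulrAC ler_pM2r //; lra.
Qed.

Lemma abs_cvgX f l k : abs_cvg F f l -> abs_cvg F (fun t => f t ^+ k) (l ^+ k).
Proof.
move=> fl; elim: k => [|k IH]; first exact: abs_cvg_cst.
rewrite exprS; apply: abs_cvg_ext (abs_cvgM fl IH) => t; exact/esym/exprS.
Qed.

Lemma abs_cvg_horner f l (p : {poly L}) :
  abs_cvg F f l -> abs_cvg F (fun t => p.[f t]) p.[l].
Proof.
move=> fl; elim/poly_ind: p => [|p c IH].
  by rewrite horner0; apply: abs_cvg_ext (abs_cvg_cst 0) => t; rewrite horner0.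
rewrite hornerMXaddC.
apply: abs_cvg_ext (abs_cvgD (abs_cvgM IH fl) (abs_cvg_cst c)) => t.
by rewrite hornerMXaddC.
Qed.

Lemma abs_cvg_sum (I : Type) (s : seq I) (f : I -> T -> L) (l : I -> L) :
  (forall i, abs_cvg F (f i) (l i)) ->
  abs_cvg F (fun t => \sum_(i <- s) f i t) (\sum_(i <- s) l i).
Proof.
move=> fl; elim: s => [|i s IH].
  by rewrite big_nil; apply: abs_cvg_ext (abs_cvg_cst 0) => t; rewrite big_nil.
rewrite big_cons; apply: abs_cvg_ext (abs_cvgD (fl i) IH) => t.
by rewrite big_cons.
Qed.

Lemma abs_cvg_lt f l c : abs_cvg F f l -> w l < c -> F [set t | w (f t) < c].
Proof.
move=> fl lc; have e0 : 0 < c - w l by rewrite subr_gt0.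
apply: filterS (fl _ e0) => t /= ft.
have := absvalD wP (f t - l) l; rewrite subrK => /le_lt_trans; apply.
by rewrite -ltrBrDr.
Qed.

Lemma abs_cvg_gt f l c : abs_cvg F f l -> c < w l -> F [set t | c < w (f t)].
Proof.
move=> fl lc; have e0 : 0 < w l - c by rewrite subr_gt0.
apply: filterS (fl _ e0) => t /= ft.
by apply: lt_le_trans (absval_ler_sub l (f t)); rewrite ltrBrDr addrC -ltrBrDr.
Qed.

End Convergence.

Lemma absval_geometric a : w a < 1 -> abs_cvg \oo (fun k => a ^+ k) 0.
Proof.
move=> a1 e e0; have [->|a0] := eqVneq a 0.
  by exists 1%N => // -[//|k] _ /=; rewrite expr0n subr0 absval0.
have wa := absval_gt0 a0; pose t := (w a)^-1 - 1.
have t0 : 0 < t by rewrite subr_gt0 invf_gt1.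
have bernoulli k : 1 + t *+ k <= (w a)^-1 ^+ k.
  have -> : (w a)^-1 = t + 1 by rewrite subrK.
  by rewrite addrC; apply: bernoulli_ineq; exact: ltW.
exists (Num.bound (e^-1 / t)) => // k /= Nk.
rewrite subr0 absvalX -[e]invrK -[w a]invrK exprVn ltf_pV2 ?posrE ?invr_gt0 ?exprn_gt0 ?invr_gt0 //.
apply: lt_le_trans (bernoulli k).
have := archi_boundP (divr_ge0 (ltW (_ : 0 < e^-1)) (ltW t0)).
rewrite invr_gt0 e0 => /(_ isT); rewrite ltr_pdivrMr // => h.
apply: (lt_le_trans h); rewrite mulrC mulr_natr.
by rewrite (le_trans (ler_wpMn2l (ltW t0) Nk)) // lerDr.
Qed.

(** As [k] grows this tends to 0 where [w a < 1] and to 1 where [w a > 1]; nothing is claimed where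
    [w a = 1]. *)
Definition switch (a : L) (k : nat) : L := a ^+ k / (1 + a ^+ k).

Lemma switch_cvg0 a : w a < 1 -> abs_cvg \oo (switch a) 0.
Proof.
move=> a1; have c := absval_geometric a1.
have FF : Filter \oo by exact: eventually_filter.
have := abs_cvgM FF c (abs_cvgV FF _ (abs_cvgD FF (abs_cvg_cst FF 1) c)).
by rewrite mul0r; apply; rewrite addr0 oner_neq0.
Qed.

Lemma switch_cvg1 a : 1 < w a -> abs_cvg \oo (switch a) 1.
Proof.
move=> a1; have FF : Filter \oo by exact: eventually_filter.
have a0 : a != 0 by apply: contraTneq a1 => ->; rewrite absval0 ltr10.
have c : abs_cvg \oo (fun k => a^-1 ^+ k) 0.
  by apply: absval_geometric; rewrite absvalV invf_lt1 // (lt_trans _ a1).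
have := abs_cvgV FF _ (abs_cvgD FF (abs_cvg_cst FF 1) c).
rewrite addr0 invr1 => /(_ (oner_neq0 _)); apply: (abs_cvg_ext FF) => k.
rewrite /switch -[RHS]invf_div; congr (_^-1).
by rewrite exprVn mulrDl divff ?expf_neq0 // mul1r addrC.
Qed.

Lemma nontrivial_absval_gt1 : nontrivial_absval w -> exists a, 1 < w a.
Proof.
case=> a a0; rewrite neq_lt => /orP[a1|a1]; last by exists a.
by exists a^-1; rewrite absvalV invf_gt1 // absval_gt0.
Qed.

End AbsvalTheory.

(** * Absolute values defining the same topology *)

Section SameTopology.
Variables (R : realType) (K : fieldType).
Implicit Types v w : K -> R.

(** Balls are compared by scaling: if [v c < 1] and [w (c ^+ N) < e], then [v (y - x) < v (c ^+ N)]
    gives [w ((y - x) / c ^+ N) < 1], hence [w (y - x) < e]. *)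
Lemma absval_open_sub v w : is_absval v -> is_absval w ->
  nontrivial_absval v -> (forall x, v x < 1 -> w x < 1) ->
  forall U, absval_open w U -> absval_open v U.
Proof.
move=> vP wP vnt vw U wU x Ux; have [e e0 eU] := wU x Ux.
have [a a1] := nontrivial_absval_gt1 vP vnt.
have a0 : a != 0 by apply: contraTneq a1 => ->; rewrite absval0 // ltr10.
set c := a^-1; have c0 : c != 0 by rewrite invr_eq0.
have vc1 : v c < 1 by rewrite absvalV // invf_lt1 // absval_gt0.
have [N _ /(_ N (leqnn N))/= cN] := absval_geometric wP (vw _ vc1) e0.
rewrite subr0 in cN.
have vcN := absval_gt0 vP (expf_neq0 N c0).
exists (v (c ^+ N)) => // y yx; apply: eU.
apply: lt_trans cN; rewrite -(subrK (c ^+ N) (y - x)).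
have cN0 := expf_neq0 N c0.
have -> : y - x - c ^+ N + c ^+ N = (y - x) / c ^+ N * c ^+ N.
  by rewrite divfK // subrK.
rewrite absvalM // gtr_pMl ?absval_gt0 //; apply: vw.
by rewrite absvalM // absvalV // ltr_pdivrMr // mul1r.
Qed.

(** The implication forces its converse: if [w x < 1 <= v x] and [v a > 1], then
    [v (a^-1 / x ^+ N) < 1] for all N, so [w a^-1 < w (x ^+ N)], which fails for large N. *)
Lemma same_topology_lt1 v w : is_absval v -> is_absval w ->
  nontrivial_absval v -> (forall x, v x < 1 -> w x < 1) -> same_topology v w.
Proof.
move=> vP wP vnt vw.
have [a a1] := nontrivial_absval_gt1 vP vnt.
have a0 : a != 0 by apply: contraTneq a1 => ->; rewrite absval0 // ltr10.
have wv x : w x < 1 -> v x < 1.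
  move=> wx1; rewrite ltNge; apply/negP => vx1.
  have [N _ /(_ N (leqnn N))/=] :=
    absval_geometric wP wx1 (absval_gt0 wP (invr_neq0 a0)).
  rewrite subr0; apply/negP; rewrite -leNgt ltW //.
  have x0 : x != 0 by apply: contraTneq vx1 => ->; rewrite absval0 // -ltNge ltr01.
  have xN0 := expf_neq0 N x0.
  rewrite -[ltRHS]mul1r -ltr_pdivrMr ?absval_gt0 //.
  rewrite -absvalV // -absvalM //; apply: vw.
  rewrite (absvalM vP) !(absvalV vP) (absvalX vP) -invfM.
  rewrite invf_lt1 ?mulr_gt0 ?exprn_gt0 ?absval_gt0 //.
  by rewrite (lt_le_trans a1) // ler_peMr ?absval_ge0 // exprn_ege1.
have wnt : nontrivial_absval w.
  exists a^-1; rewrite ?invr_eq0 // lt_eqF //; apply: vw.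
  by rewrite absvalV // invf_lt1 // (lt_trans ltr01).
by move=> U; split; [exact: absval_open_sub wv _ | exact: absval_open_sub vw _].
Qed.

(** Inequivalence gives [b] with [v b < 1 <= w b] and, by symmetry, [c] with [w c < 1 <= v c]; the
    quotient [c / b] is the witness. *)
Lemma absval_opposite v w : is_absval v -> is_absval w ->
  nontrivial_absval v -> nontrivial_absval w -> ~ same_topology v w ->
  exists a, 1 < v a /\ w a < 1.
Proof.
move=> vP wP vnt wnt nvw.
have sep v' w' : is_absval v' -> is_absval w' -> nontrivial_absval v' ->
    ~ same_topology v' w' -> exists b, v' b < 1 /\ 1 <= w' b.
  move=> v'P w'P v'nt nvw'; apply/not_existsP => h; apply: nvw'.
  apply: same_topology_lt1 => // x vx; rewrite ltNge; apply/negP => wx.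
  by apply: (h x).
have [b [vb wb]] := sep v w vP wP vnt nvw.
have [c [wc vc]] : exists c, w c < 1 /\ 1 <= v c.
  by apply: sep => // wv; apply: nvw => U; split=> /wv.
have b0 : b != 0 by apply: contraTneq wb => ->; rewrite absval0 // -ltNge ltr01.
exists (c / b); rewrite (absvalM vP) (absvalM wP) (absvalV vP) (absvalV wP); split.
  rewrite ltr_pdivlMr ?absval_gt0 // mul1r; exact: lt_le_trans vc.
rewrite ltr_pdivrMr ?mul1r ?(lt_le_trans wc) //; exact: lt_le_trans wb.
Qed.

End SameTopology.

(** * Simultaneous approximation for inequivalent absolute values *)

Section ArtinWhaples.
Variables (R : realType) (K : fieldType) (I : eqType) (w : I -> K -> R).
Hypothesis wP : forall i, is_absval (w i).
Hypothesis wnt : forall i, nontrivial_absval (w i).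
Hypothesis wD : forall i j, i != j -> ~ same_topology (w i) (w j).

Let FF : Filter \oo := eventually_filter.

(** Induction on [s]: [a] serves for the old indices and [b] separates [i] from the new index [j].
    If [w j a <= 1], then [a ^+ k * b] works for large [k]. Otherwise powers of [a] would spoil [b]
    at [j], and [switch a k * b] is used: it tends to [b] at [i] and [j] and to 0 at the old
    indices. *)
Lemma separating_element i (s : seq I) : i \notin s ->
  exists a, 1 < w i a /\ forall j, j \in s -> w j a < 1.
Proof.
elim: s => [_|j s IH]; first by have [a a1] := nontrivial_absval_gt1 (wP i) (wnt i); exists a.
rewrite inE negb_or => /andP[ij /IH[a [a1 as1]]].
have [b [b1 bj]] := absval_opposite (wP i) (wP j) (wnt i) (wnt j) (wD ij).
suff [c [ci cj cs]] : exists c : nat -> K,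
    [/\ \oo [set k | 1 < w i (c k)], \oo [set k | w j (c k) < 1] &
      forall j', j' \in s -> abs_cvg (w j') \oo c 0].
  have : \oo [set k | forall j', j' \in s -> w j' (c k) < 1].
    elim: (s) cs => [|j' s' IH'] cs; first exact: filterE.
    have j'0 : w j' 0 < 1 by rewrite absval0.
    have cj' := abs_cvg_lt (wP j') FF (cs j' (mem_head _ _)) j'0.
    have IHs := IH' (fun j'' h => cs _ (mem_behead (s := j' :: s') h)).
    apply: filterS (filterI cj' IHs) => k [/= h1 h2] l.
    by rewrite inE => /predU1P[->|/h2].
  move=> cs'; have [k [h1 [h2 h3]]] := filter_ex (filterI ci (filterI cj cs')).
  by exists (c k); split=> // l; rewrite inE => /predU1P[->|/h3].
have [aj|aj] := lerP (w j a) 1.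
  exists (fun k => a ^+ k * b); split.
  - apply: filterE => k /=; rewrite absvalM // absvalX //.
    by rewrite (lt_le_trans b1) // ler_peMl ?absval_ge0 // exprn_ege1 // ltW.
  - apply: filterE => k /=; rewrite absvalM // absvalX //.
    by rewrite (le_lt_trans _ bj) // ler_piMl ?absval_ge0 // exprn_ile1 ?absval_ge0.
  - move=> l ls; rewrite -(mul0r b).
    apply: (abs_cvgM (wP l) FF); last exact: abs_cvg_cst.
    exact/absval_geometric/as1.
exists (fun k => switch a k * b).
have cvg1 l : 1 < w l a -> abs_cvg (w l) \oo (fun k => switch a k * b) b.
  move=> la; rewrite -[X in abs_cvg _ _ _ X](mul1r b).
  by apply: (abs_cvgM (wP l) FF); [exact: switch_cvg1|exact: abs_cvg_cst].
split; first by apply: (abs_cvg_gt (wP i) FF (cvg1 _ a1)).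
  by apply: (abs_cvg_lt (wP j) FF (cvg1 _ aj)).
move=> l ls; rewrite -(mul0r b).
apply: (abs_cvgM (wP l) FF); last exact: abs_cvg_cst.
exact/switch_cvg0/as1.
Qed.

(** With [a i] large at [i] and small at the other indices of [s], the sum of the
    [switch (a i) k * x i] tends to [x i] at every [i] in [s]. *)
Theorem artin_whaples (s : seq I) (x : I -> K) (e : I -> R) :
  uniq s -> (forall i, 0 < e i) ->
  exists y, forall i, i \in s -> w i (y - x i) < e i.
Proof.
move=> us e0.
have /choice[a aP] : forall i, exists a, i \in s ->
    1 < w i a /\ forall j, j \in s -> j != i -> w j a < 1.
  move=> i; case: (boolP (i \in s)) => [si|_]; last by exists 0.
  have [|a [a1 a2]] := @separating_element i (rem i s).
    by rewrite mem_rem_uniq // inE eqxx.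
  by exists a => _; split=> // j js ji; apply: a2; rewrite mem_rem_uniq // inE ji.
pose y k := \sum_(i <- s) (if i \in s then switch (a i) k * x i else 0).
have ycvg i : i \in s -> abs_cvg (w i) \oo y (x i).
  move=> si; have -> : x i = \sum_(j <- s) (if j == i then x i else 0).
    by rewrite (bigD1_seq i) //= eqxx big1 ?addr0 // => j /negPf->.
  apply: (abs_cvg_sum (wP i) FF) => j.
  case: (eqVneq j i) => [->|ji].
    rewrite si -[X in abs_cvg _ _ _ X](mul1r (x i)).
    apply: (abs_cvgM (wP i) FF); last exact: abs_cvg_cst.
    by apply: switch_cvg1 => //; have [] := aP i si.
  case: (boolP (j \in s)) => [sj|_]; last exact: abs_cvg_cst.
  rewrite -[X in abs_cvg _ _ _ X](mul0r (x j)).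
  apply: (abs_cvgM (wP i) FF); last exact: abs_cvg_cst.
  have [_ j2] := aP j sj.
  by apply: switch_cvg0 => //; apply: j2; rewrite // eq_sym.
have : \oo [set k | forall i, i \in s -> w i (y k - x i) < e i].
  have : {subset s <= s} by [].
  elim: {1 3}s => [|i s' IH] ss; first exact: filterE.
  have IHs := IH (fun j h => ss _ (mem_behead (s := i :: s') h)).
  apply: filterS (filterI (ycvg i (ss _ (mem_head _ _)) _ (e0 i)) IHs).
  by move=> k [/= h1 h2] l; rewrite inE => /predU1P[->|/h2].
by case/filter_ex => k ky; exists (y k).
Qed.

End ArtinWhaples.

(** * Neighbourhoods of local points *)

Section PointNeighbourhoods.
Variables (R : realType) (K : fieldType) (X : variety K).
Variables (v : place R K) (Kv : completion v).

Local Notation w := (@completion_abs _ _ _ Kv).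
Local Notation wP := (completion_absP Kv).

(** The subbasic open sets ask a rational function to be regular with value in an open set, and only
    these have to be tested. *)
Lemma analytic_cvg (F : set_system (local_point X Kv)) (P : local_point X Kv) :
  Filter F ->
  (forall f c e, sval P f = Some c -> 0 < e ->
    F [set P' | exists2 c', sval P' f = Some c' & w (c' - c) < e]) ->
  F --> P.
Proof.
move=> FF FP U; rewrite nbhsE => -[_ [[B sB <-] [C BC CP]] sU].
apply: filterS sU _; apply: (@filterS _ _ _ C) => [Q ?|]; first by exists C.
have /sB [D sD DC] := BC; rewrite -DC; apply: filter_bigI => E ED.
have /sD := ED; rewrite inE => -[f [W [oW EW]]].
move: CP; rewrite -DC => /(_ E ED); rewrite EW => -[c Pc Wc].
have [e e0 eW] := oW c Wc.
apply: filterS (FP f c e Pc e0) => Q [c' Qc' cc'].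
by exists c' => //; apply: eW.
Qed.

Variables (A : set (rat_fun X)) (G : set (rat_fun X)).
Variable phi : rat_fun X -> Kv.

Definition hom_nbhs : set_system (rat_fun X -> Kv) :=
  [set S | exists2 eta, 0 < eta & forall psi, alg_hom_on (completion_emb Kv) A psi ->
     (forall g, G g -> w (psi g - phi g) < eta) -> S psi].

Lemma hom_nbhs_filter : Filter hom_nbhs.
Proof.
split.
- by exists 1.
- move=> S T [e e0 eS] [d d0 dT]; exists (Num.min e d); first by rewrite lt_min e0.
  move=> psi psiA psiG; split; [apply: eS|apply: dT] => // g /psiG;
    by rewrite lt_min => /andP[].
- by move=> S T ST [e e0 eS]; exists e => // psi psiA psiG; apply/ST/eS.
Qed.

#[local] Existing Instance hom_nbhs_filter.
Let FH := hom_nbhs_filter.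

Hypothesis phiA : alg_hom_on (completion_emb Kv) A phi.

(* The hypothesis says that A is the subalgebra generated by G. *)
Hypothesis genA : forall S : set (rat_fun X), (forall c, S (rat_cst X c)) ->
  (forall a b, A a -> A b -> S a -> S b -> S (a + b) /\ S (a * b)) ->
  G `<=` S -> A `<=` S.

Lemma hom_nbhs_cvg a : A a -> abs_cvg w hom_nbhs (fun psi => psi a) (phi a).
Proof.
have isH : hom_nbhs [set psi | alg_hom_on (completion_emb Kv) A psi].
  by exists 1.
have phiD := phiA.2.
move: a; apply: genA => [c|a b Aa Ab ca cb|g Gg].
- have [phic _] := phiA; rewrite phic.
  apply: (abs_cvg_near FH) (abs_cvg_cst wP FH _).
  by apply: filterS isH => psi [psic _] /=; rewrite psic.
- have [-> ->] := phiD a b Aa Ab; split.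
    apply: (abs_cvg_near FH) (abs_cvgD wP FH ca cb).
    by apply: filterS isH => psi [_ psiD] /=; have [-> _] := psiD a b Aa Ab.
  apply: (abs_cvg_near FH) (abs_cvgM wP FH ca cb).
  by apply: filterS isH => psi [_ psiD] /=; have [_ ->] := psiD a b Aa Ab.
- by move=> e e0; exists e => // psi psiA; apply.
Qed.

(** [Q] only has to agree with [psi] on fractions of [A], so the statement applies to a point
    constructed on another chart. The sets [U] satisfying the conclusion form a filter, which is
    shown to converge to [P]. *)
Lemma nbhs_hom (P : local_point X Kv) (U : set (local_point X Kv)) :
  (forall f c, sval P f = Some c <-> exists a b,
     [/\ A a, A b, phi b != 0, b * f = a & c = phi a / phi b]) ->
  nbhs P U ->
  hom_nbhs [set psi | forall Q : local_point X Kv,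
    (forall f a b, A a -> A b -> psi b != 0 -> b * f = a ->
       sval Q f = Some (psi a / psi b)) -> U Q].
Proof.
move=> PE.
pose F : set_system (local_point X Kv) := [set U |
  hom_nbhs [set psi | forall Q : local_point X Kv,
    (forall f a b, A a -> A b -> psi b != 0 -> b * f = a ->
       sval Q f = Some (psi a / psi b)) -> U Q]].
suff: F --> P by apply.
apply: analytic_cvg => [|f c e /PE[a [b [Aa Ab b0 bf ->]]] e0].
  split.
  - by apply: (@filterE _ hom_nbhs) => psi Q.
  - move=> S T FS FT.
    apply: (@filterS _ hom_nbhs _ _ _ _ (@filterI _ hom_nbhs _ _ _ FS FT)).
    by move=> psi [h1 h2] Q hQ; split; [apply: h1|apply: h2].
  - by move=> S T ST FS; apply: (@filterS _ hom_nbhs _ _ _ _ FS) => psi h Q hQ; apply/ST/h.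
have cb := hom_nbhs_cvg Ab.
have cab := abs_cvgM wP FH (hom_nbhs_cvg Aa) (abs_cvgV wP FH b0 cb).
apply: filterS (filterI (abs_cvg_neq0 wP FH b0 cb) (cab _ e0)) => psi [/= pb h] Q hQ.
by exists (psi a / psi b) => //; apply: hQ.
Qed.

End PointNeighbourhoods.

(** Sets containing a box with finitely many restricted factors form a filter converging to [P] in
    each coordinate, hence in the product. *)
Lemma nbhs_prod_topology (I : Type) (T : I -> topologicalType)
    (P : prod_topology T) (O : set (prod_topology T)) : nbhs P O ->
  exists (l : seq {classic I}) (U : forall i, set (T i)),
    (forall i, nbhs (P i) (U i)) /\
    forall Q : prod_topology T, (forall i, (i : {classic I}) \in l -> U i (Q i)) -> O Q.
Proof.
pose F : set_system (prod_topology T) := [set O |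
  exists (l : seq {classic I}) (U : forall i, set (T i)),
    (forall i, nbhs (P i) (U i)) /\
    forall Q : prod_topology T, (forall i, (i : {classic I}) \in l -> U i (Q i)) -> O Q].
have FF : Filter F.
  split.
  - exists [::], (fun=> setT); split=> // i; exact: filterT.
  - move=> S S' [l [U [PU US]]] [l' [U' [PU' US']]].
    exists (l ++ l'), (fun i => U i `&` U' i); split=> [i|Q hQ]; first exact: filterI.
    by split; [apply: US|apply: US'] => i il; have [] := hQ i _;
      rewrite ?mem_cat ?il ?orbT.
  - by move=> S S' SS' [l [U [PU US]]]; exists l, U; split=> // Q /US/SS'.
suff: F --> P by apply.
apply/cvg_sup => i B; rewrite nbhsE => -[_ [[V oV <-] VP] VB].
apply: filterS VB _.
(* Only the factor [i] is restricted: the cast transports [y] along an equality of indices, and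
   without such an equality the condition is vacuous. *)
exists [:: (i : {classic I})], (fun j => [set y | forall (e : j = i), V (ecast j (T j) e y)]).
split=> [j|Q]; last by move=> /(_ i (mem_head _ _) erefl).
have [ji|ji] := pselect (j = i); last by apply: filterE => y e; case: (ji e).
subst j; apply: (filterS _ (open_nbhs_nbhs (conj oV VP))) => y Vy e.
by rewrite (Prop_irrelevance e erefl).
Qed.

(** * Invariants of the charts *)

Section Charts.
Variables (K : fieldType) (h : {poly K}) (n : nat).

Local Notation D := {mpoly K[n.+1]}.
Local Notation E := {fraction D}.
Local Notation FR := (fun_ring h n).
Local Notation emb := (fun_emb h n).
Local Notation index := (bool * {ffun 'I_n -> bool})%type.
Local Notation G := (genus_succ h).
Local Notation subalg := (@is_subalg K h n).
Local Notation x_ := (@coordinate K n ord0).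

Definition base_gen (i : index) : FR := emb (if i.1 then x_^-1 else x_).

(** Index [ord0] stands for the coordinate y of the curve, or y / x^(g+1) at infinity, and
    [lift ord0 j] for the coordinate of the j-th line. The involution negates them all. *)
Definition odd_gen (i : index) (a : 'I_n.+1) : FR :=
  if unlift ord0 a is Some j then line_gen h j (i.2 j)
  else if i.1 then fun_y h n * emb (x_ ^- G) else fun_y h n.

Definition even_gens (i : index) : set FR :=
  [set base_gen i] `|` [set odd_gen i a * odd_gen i b | a in setT & b in setT].

Lemma odd_gen0 i : odd_gen i ord0 =
  if i.1 then fun_y h n * emb (x_ ^- G) else fun_y h n.
Proof. by rewrite /odd_gen unlift_none. Qed.

Lemma odd_genS i j : odd_gen i (lift ord0 j) = line_gen h j (i.2 j).
Proof. by rewrite /odd_gen liftK. Qed.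

Local Notation chart_ring := (@chart K (curve_times_lines h n)).
Local Notation inv := (fun_inv h n).

Lemma subalg_smallest (S : set FR) : subalg (smallest subalg S).
Proof.
split=> [c T [[Tc _] _]|a b aS bS]; first exact: Tc.
by split=> T TS; have [[_ /(_ a b (aS T TS) (bS T TS))[]]] := TS.
Qed.

Lemma chart_subalg i : subalg (chart_ring i).
Proof. exact: subalg_smallest. Qed.

Lemma chart_base_gen i : chart_ring i (base_gen i).
Proof.
apply: sub_gen_smallest; left; rewrite /curve_gens /base_gen.
by case: ifP; left.
Qed.

Lemma chart_odd_gen i a : chart_ring i (odd_gen i a).
Proof.
apply: sub_gen_smallest; rewrite /odd_gen; case: unliftP => [j _|_].
  by right; exists j.
by left; rewrite /curve_gens; case: ifP; right.
Qed.

Lemma chart_min i (S : set FR) : subalg S -> S (base_gen i) ->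
  (forall a, S (odd_gen i a)) -> chart_ring i `<=` S.
Proof.
move=> Salg Sb So; apply: smallest_sub => // f [|[j _ <-]]; last first.
  by rewrite -odd_genS.
have := So ord0; rewrite odd_gen0; move: Sb; rewrite /base_gen /curve_gens.
by case: ifP => _ ? ? [->|->].
Qed.

Definition invariants (i : index) : set FR := [set f | chart_ring i f /\ inv f = f].

Lemma subalg_sum (S : set FR) (I : Type) (s : seq I) (F : I -> FR) :
  subalg S -> (forall j, S (F j)) -> S (\sum_(j <- s) F j).
Proof.
move=> [Sc SD] SF; apply: (big_ind S) => // [|a b Sa Sb].
  by rewrite -(rmorph0 (fun_cst h n)).
by have [] := SD a b Sa Sb.
Qed.

Lemma invariants_subalg i : subalg (invariants i).
Proof.
have [Ac AD] := chart_subalg i; split=> [c|a b [Aa ia] [Ab ib]].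
  by split=> //; rewrite fun_inv_cst.
by have [ABD ABM] := AD a b Aa Ab; rewrite /invariants /= rmorphD rmorphM ia ib.
Qed.

Lemma inv_base_gen i : inv (base_gen i) = base_gen i.
Proof.
rewrite /base_gen fun_inv_emb; congr (emb _).
by case: ifP => _; rewrite ?fmorphV /= base_inv_coord eqxx.
Qed.

Lemma inv_odd_gen i a : inv (odd_gen i a) = - odd_gen i a.
Proof.
rewrite /odd_gen; case: unliftP => [j _|_].
  rewrite /line_gen fun_inv_emb -rmorphN; congr (emb _).
  by case: ifP => _; rewrite ?fmorphV /= base_inv_coord //= invrN.
case: ifP => _; last exact: fun_inv_y.
rewrite rmorphM fun_inv_y fun_inv_emb fmorphV rmorphXn /=.
by rewrite base_inv_coord eqxx mulNr.
Qed.

Lemma even_gens_invariants i : even_gens i `<=` invariants i.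
Proof.
move=> _ [->|[a _ [b _ <-]]].
  by split; [exact: chart_base_gen|exact: inv_base_gen].
split; last by rewrite rmorphM !inv_odd_gen mulrNN.
have [_ AM] := chart_subalg i.
by have [] := AM _ _ (@chart_odd_gen i a) (@chart_odd_gen i b).
Qed.

(* The chart is B + \sum_a w_a B, where B is generated by the base coordinate
   and the products of two odd coordinates w_a; the even part is B. *)
Lemma invariants_min i (two : (2%:R : K) != 0) (S' : set FR) :
  subalg S' -> even_gens i `<=` S' -> invariants i `<=` S'.
Proof.
move=> Salg' GS' f [fi invf].
pose S : set FR := S' `&` invariants i.
suff: S f by case.
have Salg : subalg S.
  have [Ic ID] := invariants_subalg i; have [Sc' SD'] := Salg'.
  split=> [c|a b [Sa Ia] [Sb Ib]]; first by split.
  have [? ?] := SD' a b Sa Sb; have [? ?] := ID a b Ia Ib.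
  by split; split.
have GS : even_gens i `<=` S.
  by move=> g Gg; split; [exact: GS'|exact: even_gens_invariants].
have Sinv g : S g -> inv g = g by case=> _ [].
have [Sc SDM] := Salg.
have SD a b : S a -> S b -> S (a + b) by move=> Sa Sb; have [] := SDM a b Sa Sb.
have SM a b : S a -> S b -> S (a * b) by move=> Sa Sb; have [] := SDM a b Sa Sb.
have S0 : S 0 by rewrite -(rmorph0 (fun_cst h n)).
pose w := odd_gen i.
have Sw a b : S (w a * w b) by apply: GS; right; exists a => //; exists b.
pose V : set FR := [set g | exists e c,
  [/\ S e, (forall a, S (c a)) & g = e + \sum_a w a * c a]].
have V1 e : S e -> V e.
  move=> Se; exists e, (fun=> 0); split=> //.
  by rewrite big1 ?addr0 // => a _; rewrite mulr0.
have Valg : subalg V.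
  split=> [c|_ _ [e [c [Se Sc1 ->]]] [e' [c' [Se' Sc' ->]]]]; first exact: V1.
  split.
    exists (e + e'), (fun a => c a + c' a); split; [exact: SD|by move=> a; exact: SD|].
    rewrite addrACA -big_split /=; congr (_ + _); apply: eq_bigr => a _.
    by rewrite mulrDr.
  (* In a product, the terms with two odd factors join the even part and those with one remain
     odd. *)
  exists (e * e' + \sum_a \sum_b (w a * w b) * (c a * c' b)),
         (fun a => e * c' a + e' * c a); split.
  - apply: SD; first exact: SM.
    apply: subalg_sum => // a; apply: subalg_sum => // b.
    by apply: (SM); [exact: Sw|exact: SM].
  - by move=> a; apply: SD; exact: SM.
  - pose u := \sum_a w a * c a; pose u' := \sum_a w a * c' a.
    have -> : \sum_a \sum_b (w a * w b) * (c a * c' b) = u * u'.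
      rewrite mulr_suml; apply: eq_bigr => a _; rewrite mulr_sumr.
      by apply: eq_bigr => b _; exact: mulrACA.
    have -> : \sum_a w a * (e * c' a + e' * c a) = e * u' + e' * u.
      rewrite !mulr_sumr -big_split /=; apply: eq_bigr => a _.
      by rewrite mulrDr !(mulrCA (w a)).
    rewrite -/u -/u' mulrDl !mulrDr (mulrC u e') -!addrA; congr (_ + _).
    by rewrite addrA addrC.
have Vf : V f.
  apply: chart_min fi => // [|a]; first by apply/V1/GS; left.
  exists 0, (fun b => if b == a then 1 else 0); split=> //.
    by move=> b; case: ifP => // _; rewrite -(rmorph1 (fun_cst h n)).
  rewrite add0r (bigD1 a) //= eqxx mulr1 big1 ?addr0 // => b /negPf->.
  exact: mulr0.
pose half := fun_cst h n (2%:R)^-1.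
have halfK g : half * (g + g) = g.
  rewrite -mulr2n -[g *+ 2]mulr_natl mulrA -(rmorph_nat (fun_cst h n)) /half.
  by rewrite -rmorphM mulVf // rmorph1 mul1r.
have [e [c [Se Sc1 fE]]] := Vf.
suff -> : f = e by [].
(* Averaging [f] with its image under the involution kills the odd part. *)
rewrite -(halfK f) -[in X in _ + X]invf fE rmorphD rmorph_sum /= Sinv //.
rewrite addrACA -big_split /= big1 ?addr0 ?halfK // => a _.
by rewrite rmorphM inv_odd_gen (Sinv (c a)) // mulNr addrN.
Qed.

End Charts.
Arguments invariants {K} h {n} i _.
Arguments even_gens {K} h {n} i _.

(** * Evaluation at parameters *)

Lemma qpolyC_in_qpoly (A : nzRingType) (p : {poly A}) c :
  qpolyC p c = in_qpoly p c%:P.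
Proof.
apply: val_inj; rewrite /= Pdiv.Ring.rmodp_small //.
by rewrite (leq_ltn_trans (size_polyC_leq1 _)) // size_mk_monic_gt1.
Qed.

Lemma coordinate_neq0 (K : fieldType) (n : nat) a : @coordinate K n a != 0.
Proof.
rewrite /coordinate tofrac_eq0; apply/eqP => /(congr1 (mcoeff U_(a))) /eqP.
by rewrite mcoeffX eqxx mcoeff0 oner_eq0.
Qed.

Section RationalParameters.
Variables (K L : fieldType) (iota : {rmorphism K -> L}) (h : {poly K}) (n : nat).

(* The parameters are x and the quotients s_j = z_j / y; they are birational
   coordinates on the quotient. *)
Definition height (k : 'I_n.+1 -> L) : L := (map_poly iota h).[k ord0].

(** At such parameters x, y and all the z_j are nonzero, so the point lies in every chart. *)
Definition generic (k : 'I_n.+1 -> L) : Prop :=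
  height k != 0 /\ forall a, k a != 0.

Definition base_val (i : bool * {ffun 'I_n -> bool}) (k : 'I_n.+1 -> L) : L :=
  if i.1 then (k ord0)^-1 else k ord0.

(* The values of the odd coordinates, divided by a square root of [height k]. *)
Definition odd_val (i : bool * {ffun 'I_n -> bool}) (k : 'I_n.+1 -> L)
    (a : 'I_n.+1) : L :=
  if unlift ord0 a is Some j
  then if i.2 j then (k a * height k)^-1 else k a
  else if i.1 then k ord0 ^- genus_succ h else 1.

End RationalParameters.

Section Evaluation.
Variables (K : fieldType) (h : {poly K}) (n : nat).

Local Notation D := {mpoly K[n.+1]}.
Local Notation E := {fraction D}.
Local Notation FR := (fun_ring h n).
Local Notation emb := (fun_emb h n).
Local Notation index := (bool * {ffun 'I_n -> bool})%type.
Local Notation G := (genus_succ h).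
Local Notation subalg := (@is_subalg K h n).
Local Notation inv := (fun_inv h n).
Local Notation eqn := (curve_eqn h n).

(** Elements of [fun_ring] have coefficients in a fraction field and may have poles; polynomials in
    the coordinates and y can be evaluated everywhere. *)
Definition of_poly : {rmorphism {poly D} -> FR} :=
  (in_qpoly eqn \o map_poly (@FracField.tofrac D))%FUN.

Lemma of_polyC a : of_poly a%:P = emb (FracField.tofrac a).
Proof. by rewrite /fun_emb /= qpolyC_in_qpoly map_polyC. Qed.

Lemma of_polyX : of_poly 'X = fun_y h n.
Proof. by rewrite /of_poly /= map_polyX. Qed.

Definition hmpoly : D := (map_poly (@mpolyC n.+1 K) h).['X_ord0].

Lemma tofrac_hmpoly : FracField.tofrac hmpoly =
  (map_poly (@coord_cst K n) h).[coordinate K ord0].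
Proof. by rewrite /hmpoly -horner_map /= -map_poly_comp. Qed.

(** Division by the monic polynomial Y^2 - h(x) works over the polynomial ring already. The
    remainder has degree below 2, so it represents its own class modulo [curve_eqn] and must
    vanish. *)
Lemma of_poly_ker p : of_poly p = 0 -> exists q, p = q * ('X^2 - hmpoly%:P).
Proof.
set Q := 'X^2 - _ => p0.
have monQ : Q \is monic.
  rewrite monicE /Q lead_coefDl ?lead_coefXn // size_polyN size_polyXn.
  by rewrite (leq_ltn_trans (size_polyC_leq1 _)).
have mapQ : map_poly (@FracField.tofrac D) Q = eqn.
  by rewrite /Q rmorphB /= map_polyXn map_polyC /= tofrac_hmpoly.
have mon : eqn \is monic by rewrite -mk_monic_curve_eqn monic_mk_monic.
have inj : injective (@FracField.tofrac D).
  by move=> a b /eqP; rewrite tofrac_eq => /eqP.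
have := congr1 val p0; rewrite /= mk_monic_curve_eqn.
rewrite {1}(Pdiv.RingMonic.rdivp_eq monQ p) rmorphD rmorphM /= mapQ.
rewrite Pdiv.RingMonic.rmodp_addl_mul_small //; last first.
  rewrite -mapQ !(size_map_inj_poly inj (rmorph0 _)).
  by rewrite Pdiv.Ring.ltn_rmodpN0 // monic_neq0.
move=> r0; exists (Pdiv.CommonRing.rdivp p Q).
rewrite {1}(Pdiv.RingMonic.rdivp_eq monQ p) -[RHS]addr0; congr (_ + _).
by apply: (map_inj_poly inj (rmorph0 _)); rewrite r0 rmorph0.
Qed.

Variable k : 'I_n.+1 -> K.
Local Notation d := (height idfun h k).
Hypothesis kP : generic idfun h k.

Let dE : d = h.[k ord0].
Proof. by rewrite /height map_poly_id. Qed.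

(* [T] is the value of y, which need not lie in K. *)
Variables (M : comNzRingType) (C : {rmorphism K -> M}) (T : M).
Hypothesis TT : T * T = C d.

Definition mpoly_val : {rmorphism D -> M} :=
  mmap C (fun a => if a == ord0 then C (k a) else C (k a) * T).

Definition poly_val : {rmorphism {poly D} -> M} :=
  @horner_morph _ _ mpoly_val T (fun a => mulrC _ _).

Lemma poly_valC a : poly_val a%:P = mpoly_val a.
Proof. exact: horner_morphC. Qed.

Lemma poly_valX : poly_val 'X = T.
Proof. exact: horner_morphX. Qed.

Lemma mpoly_valX a : mpoly_val 'X_a = if a == ord0 then C (k a) else C (k a) * T.
Proof. by rewrite /= mmapX mmap1U. Qed.

Lemma mpoly_val_hmpoly : mpoly_val hmpoly = C d.
Proof.
rewrite dE /hmpoly -(horner_map mpoly_val) -(horner_map C) mpoly_valX eqxx -map_poly_comp.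
by congr (_.[_]); apply: eq_map_poly => c; rewrite /= mmapC.
Qed.

Lemma poly_val_ker p : of_poly p = 0 -> poly_val p = 0.
Proof.
move=> /of_poly_ker[q ->]; rewrite rmorphM rmorphB rmorphXn.
by rewrite poly_valX poly_valC mpoly_val_hmpoly expr2 TT subrr mulr0.
Qed.

(** Here [f] is a fraction p / m with value [o]. Since [M] may have zero divisors, the denominator
    has to take a nonzero value in [K], which is a unit. *)
Definition has_val (f : FR) (o : M) : Prop := exists p m c,
  [/\ c != 0, of_poly m * f = of_poly p, poly_val m = C c & poly_val p = o * C c].

Let CV c : c != 0 -> C c * C c^-1 = 1.
Proof. by move=> c0; rewrite -rmorphM divff // rmorph1. Qed.

(** Two representations satisfy m' p = m p' in [fun_ring]. Evaluation kills the kernel of [of_poly],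
    so the equality persists in [M], where the denominators cancel. *)
Lemma has_val_inj f o o' : has_val f o -> has_val f o' -> o = o'.
Proof.
move=> [p [m [c [c0 mf mc pc]]]] [p' [m' [c' [c'0 mf' mc' pc']]]].
have : poly_val (m' * p - m * p') = 0.
  by apply: poly_val_ker; rewrite rmorphB !rmorphM -mf -mf' mulrCA subrr.
rewrite rmorphB !rmorphM mc pc mc' pc' => /eqP; rewrite subr_eq0 => /eqP e.
have e1 : o * (C c * C c') = o' * (C c * C c') by ring: e.
rewrite -[o]mulr1 -[o']mulr1 -(CV c0) -[C c]mulr1 -(CV c'0).
have -> z : z * (C c * (C c' * C c'^-1) * C c^-1) = z * (C c * C c') * (C c'^-1 * C c^-1).
  by ring.
by rewrite e1 //; ring.
Qed.

Lemma has_valC c : has_val (fun_cst h n c) (C c).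
Proof.
exists (c%:MP)%:P, 1, 1; rewrite oner_neq0 !rmorph1 mul1r mulr1; split=> //.
  by rewrite of_polyC.
by rewrite poly_valC /= mmapC.
Qed.

Lemma has_valD f g o o' : has_val f o -> has_val g o' -> has_val (f + g) (o + o').
Proof.
move=> [p [m [c [c0 mf mc pc]]]] [p' [m' [c' [c'0 mf' mc' pc']]]].
exists (m' * p + m * p'), (m * m'), (c * c'); split; first exact: mulf_neq0.
- rewrite rmorphD !rmorphM -mf -mf' mulrDr -!mulrA.
  by rewrite (mulrCA (of_poly m) (of_poly m') f).
- by rewrite !rmorphM mc mc'.
- by rewrite rmorphD !rmorphM mc mc' pc pc'; ring.
Qed.

Lemma has_valM f g o o' : has_val f o -> has_val g o' -> has_val (f * g) (o * o').
Proof.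
move=> [p [m [c [c0 mf mc pc]]]] [p' [m' [c' [c'0 mf' mc' pc']]]].
exists (p * p'), (m * m'), (c * c'); split; first exact: mulf_neq0.
- by rewrite !rmorphM -mf -mf' mulrACA.
- by rewrite !rmorphM mc mc'.
- by rewrite !rmorphM pc pc'; ring.
Qed.

Lemma has_val_base (i : index) : has_val (base_gen h i) (C (base_val i k)).
Proof.
have [_ k0] := kP; rewrite /base_gen /base_val; case: ifP => _.
  exists 1, ('X_ord0)%:P, (k ord0); split=> //.
  - by rewrite of_polyC -rmorphM divff ?coordinate_neq0 // (rmorph1 of_poly); exact: rmorph1.
  - by rewrite poly_valC mpoly_valX eqxx.
  - by rewrite rmorph1 mulrC CV.
exists ('X_ord0)%:P, 1, 1; rewrite oner_neq0 !rmorph1 mul1r mulr1; split=> //.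
  by rewrite of_polyC.
by rewrite poly_valC mpoly_valX eqxx.
Qed.

Lemma has_val_odd (i : index) a : has_val (odd_gen h i a) (T * C (odd_val idfun h i k a)).
Proof.
have [d0 k0] := kP; rewrite /odd_gen /odd_val; case: unliftP => [j ->|_].
  rewrite /line_gen; set z := coordinate _ _; set s := k _.
  have vz : poly_val ('X_(lift ord0 j))%:P = C s * T.
    by rewrite poly_valC mpoly_valX.
  case: ifP => _; last first.
    exists ('X_(lift ord0 j))%:P, 1, 1.
    rewrite oner_neq0 !rmorph1 mul1r mulr1 vz mulrC; split=> //.
    by rewrite of_polyC.
  (* 1 / z is written as z / z^2: the value [C s * T] of z need not come from [K], whereas z^2 has
     the value [s * (s * d)]. *)
  exists ('X_(lift ord0 j))%:P, ('X_(lift ord0 j) ^+ 2)%:P, (s * (s * d)); split.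
  - by rewrite !mulf_neq0 // k0.
  - rewrite !of_polyC -rmorphM; congr (emb _).
    rewrite rmorphXn expr2 -mulrA divff ?mulr1 //; exact: coordinate_neq0.
  - rewrite poly_valC rmorphXn -poly_valC vz expr2 !rmorphM -TT; ring.
  - rewrite vz mulrC -mulrA -rmorphM mulrCA mulVf ?mulr1 //.
    by rewrite mulf_neq0 // k0.
case: ifP => _; last first.
  exists 'X, 1, 1; rewrite oner_neq0 !rmorph1 mul1r !mulr1; split=> //.
    exact: esym of_polyX.
  exact: poly_valX.
exists 'X, ('X_ord0 ^+ G)%:P, (k ord0 ^+ G); split.
- exact: expf_neq0.
- have XE : FracField.tofrac ('X_ord0 ^+ G) = coordinate K ord0 ^+ G :> E.
    exact: rmorphXn.
  rewrite of_polyX of_polyC XE mulrCA -(rmorphM emb) divff;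
    last exact: expf_neq0 (coordinate_neq0 K _).
  by rewrite (rmorph1 emb) mulr1.
- by rewrite poly_valC (rmorphXn mpoly_val) mpoly_valX eqxx (rmorphXn C).
- by rewrite poly_valX -mulrA -rmorphM mulVf ?rmorph1 ?mulr1 // expf_neq0.
Qed.

Lemma has_val_even (i : index) a b : has_val (odd_gen h i a * odd_gen h i b)
  (C (d * odd_val idfun h i k a * odd_val idfun h i k b)).
Proof.
have := has_valM (has_val_odd i a) (has_val_odd i b).
by rewrite !rmorphM -TT; congr has_val; ring.
Qed.

Hypothesis two : (2%:R : K) != 0.

Definition param_val (f : FR) : K := xget 0 [set c | has_val f (C c)].

Lemma param_valE f c : has_val f (C c) -> param_val f = c.
Proof.
move=> fc; have fc' : has_val f (C (param_val f)).
  by apply: (@xgetPex _ 0 [set c | has_val f (C c)]); exists c.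
apply: (fmorph_inj C). exact: has_val_inj fc' fc.
Qed.

Definition valued : set FR := [set f | exists c, has_val f (C c)].

Lemma valued_subalg : subalg valued.
Proof.
split=> [c|f g [c fc] [e ge]]; first by exists c; exact: has_valC.
split; first by exists (c + e); rewrite rmorphD; exact: has_valD.
by exists (c * e); rewrite rmorphM; exact: has_valM.
Qed.

(** Products of two odd generators take values in [K] because [T * T = C d]; together with the base
    coordinate they generate the invariants. *)
Lemma invariants_valued i : invariants h i `<=` valued.
Proof.
apply: invariants_min => //; first exact: valued_subalg.
move=> _ [->|[a _ [b _ <-]]]; first by eexists; exact: has_val_base.
by eexists; exact: has_val_even.
Qed.

Lemma param_val_hom :
  @alg_hom_on K (curve_times_lines h n) K idfun valued param_val.
Proof.
split=> [c|f g [c fc] [e ge]]; first by apply: param_valE; exact: has_valC.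
rewrite (param_valE fc) (param_valE ge); split; apply: param_valE.
  by rewrite rmorphD; exact: has_valD.
by rewrite rmorphM; exact: has_valM.
Qed.

Lemma param_val_base i : param_val (base_gen h i) = base_val i k.
Proof. by apply: param_valE; exact: has_val_base. Qed.

Lemma param_val_even i a b : param_val (odd_gen h i a * odd_gen h i b) =
  d * odd_val idfun h i k a * odd_val idfun h i k b.
Proof. by apply: param_valE; exact: has_val_even. Qed.

End Evaluation.

(** The ring is K[T] / (T^2 - d), whether or not d is a square; it need not be a field. *)
Lemma square_root_ring (K : fieldType) (d : K) :
  exists (M : comNzRingType) (C : {rmorphism K -> M}) (T : M), T * T = C d.
Proof.
have s : (size (d%:P) < size ('X^2 : {poly K}))%N.
  by rewrite size_polyXn (leq_ltn_trans (size_polyC_leq1 _)).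
have mkE : mk_monic ('X^2 - d%:P) = 'X^2 - d%:P.
  rewrite /mk_monic -polyCN size_polyDl ?size_polyN ?polyCN ?size_polyN //.
  by rewrite size_polyXn monicE lead_coefDl ?size_polyN // lead_coefXn eqxx.
exists {poly %/ 'X^2 - d%:P}, (qpolyC ('X^2 - d%:P)), (in_qpoly _ 'X).
rewrite -rmorphM /= qpolyC_in_qpoly -expr2; apply/eqP; rewrite -subr_eq0 -rmorphB.
apply/eqP/val_inj; rewrite /= mkE Pdiv.RingMonic.rmodpp //.
by rewrite -mkE monic_mk_monic.
Qed.

(** The auxiliary square root disappears here, and a single domain [S] contains the invariants of
    all charts at once. *)
Lemma param_hom_exists (K : fieldType) (h : {poly K}) (n : nat)
    (k : 'I_n.+1 -> K) : generic idfun h k -> (2%:R : K) != 0 ->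
  exists (psi : fun_ring h n -> K) (S : set (fun_ring h n)),
  [/\ is_subalg S /\ (forall i, invariants h i `<=` S),
      @alg_hom_on K (curve_times_lines h n) K idfun S psi,
      forall i, psi (base_gen h i) = base_val i k &
      forall i a b, psi (odd_gen h i a * odd_gen h i b) =
        height idfun h k * odd_val idfun h i k a * odd_val idfun h i k b].
Proof.
move=> kP two; have [M [C [T TT]]] := square_root_ring (height idfun h k).
exists (param_val k C T), (valued k C T); split=> [||i|i a b].
- by split=> [|i]; [exact: valued_subalg|exact: invariants_valued].
- exact: param_val_hom.
- exact: param_val_base.
- exact: param_val_even.
Qed.

(** * Points of the quotient at rational parameters *)

Section PointOfHom.
Variables (K : fieldType) (X : variety K) (L : fieldType).
Variable iota : {rmorphism K -> L}.

(** Two representations a / b and a' / b' of [f] satisfy a b' = a' b, so the value of [f] does not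
    depend on the choice. *)
Lemma point_of_hom (i : chart_index X) (phi : rat_fun X -> L) :
  alg_hom_on iota (chart i) phi ->
  exists Q : Defs.point X iota, forall f c, sval Q f = Some c <->
    exists a b, [/\ chart i a, chart i b, phi b != 0, b * f = a & c = phi a / phi b].
Proof.
move=> phiP; have [_ phiM] := phiP.
pose V f : set L := [set c | exists a b,
  [/\ chart i a, chart i b, phi b != 0, b * f = a & c = phi a / phi b]].
have Vinj f c c' : V f c -> V f c' -> c = c'.
  move=> [a [b [ia ib b0 ba ->]]] [a' [b' [ia' ib' b'0 ba' ->]]].
  apply/eqP; rewrite eqr_div // -(phiM a b' ia ib').2 -(phiM a' b ia' ib).2.
  rewrite -ba -ba'; apply/eqP; congr phi; rewrite mulrAC [RHS]mulrAC.
  by congr (_ * _); exact: mulrC.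
pose P f := if pselect (exists c, V f c) is left _ then Some (xget 0 (V f)) else None.
have PE f c : P f = Some c <-> V f c.
  rewrite /P; case: pselect => [Vf|nVf]; last first.
    by split=> // Vc; case: nVf; exists c.
  have Vx := xgetPex 0 Vf; split=> [[<-]//|Vc].
  by congr Some; exact: Vinj Vx Vc.
have Ppt : is_point iota P by exists i, phi; split.
by exists (exist _ P Ppt).
Qed.

End PointOfHom.

Lemma local_point_of_point (R : realType) (K : fieldType) (X : variety K)
    (v : place R K) (Kv : completion v) (Q : Defs.point X (@idfun K)) :
  exists P : local_point X Kv,
    forall f, sval P f = omap (completion_emb Kv) (sval Q f).
Proof.
have [i [phi [phiP QE]]] := svalP Q; set e := completion_emb Kv.
have [|P PE] := @point_of_hom K X Kv e i (e \o phi).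
  have [phic phiD] := phiP; split=> [c|a b ia ib]; first by rewrite /= phic.
  by have [DE ME] := phiD a b ia ib; rewrite /= DE ME rmorphD rmorphM.
exists P => f; case Qf: (sval Q f) => [c|] /=.
  apply/PE; have /QE[a [b [ia ib b0 ba ->]]] := Qf.
  by exists a, b; split; rewrite //= ?fmorph_eq0 // fmorph_div.
case Pf: (sval P f) => [c|] //; have /PE[a [b [ia ib]]] := Pf.
rewrite /= fmorph_eq0 => b0 ba _.
suff : sval Q f = Some (phi a / phi b) by rewrite Qf.
by apply/QE; exists a, b.
Qed.

Section ParameterPoint.
Variables (K : fieldType) (h : {poly K}) (n : nat).
Local Notation FR := (fun_ring h n).
Local Notation X := (@quotient K (curve_times_lines h n) (fun_inv h n)).
Local Notation chart_ring := (@chart K (curve_times_lines h n)).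
Let i0 : bool * {ffun 'I_n -> bool} := (false, [ffun=> false]).

Variables (k : 'I_n.+1 -> K) (psi : FR -> K).
Hypothesis kP : generic idfun h k.
Variable S : set FR.
Hypothesis Salg : is_subalg S.
Hypothesis invS : forall i, invariants h i `<=` S.
Hypothesis psiP : @alg_hom_on K (curve_times_lines h n) K idfun S psi.
Hypothesis psi_base : forall i, psi (base_gen h i) = base_val i k.
Hypothesis psi_even : forall i a b, psi (odd_gen h i a * odd_gen h i b) =
  height idfun h k * odd_val idfun h i k a * odd_val idfun h i k b.

Let emb_mulV (e : {fraction {mpoly K[n.+1]}}) : e != 0 ->
  fun_emb h n e * fun_emb h n e^-1 = 1.
Proof. by move=> e0; rewrite -rmorphM divff // rmorph1. Qed.

(** [i0] is the chart with coordinates x, y, z_j. Generators of other charts are brought into it by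
    invariant factors that are nonzero at generic parameters: x for 1 / x, z^2 for 1 / z, x^(g+1)
    for y / x^(g+1). The functions admitting such a factor form an algebra. *)
Lemma clear_denominators i f : invariants h i f -> exists m,
  [/\ invariants h i0 m, psi m != 0 & invariants h i0 (m * f)].
Proof.
have [d0 k0] := kP.
have [psic psiM'] := psiP.
have psiM a b : invariants h i0 a -> invariants h i0 b ->
    psi (a + b) = psi a + psi b /\ psi (a * b) = psi a * psi b.
  by move=> /invS Sa /invS Sb; exact: psiM'.
have [Ic IM] := @invariants_subalg K h n i0.
have [Cc CM] := @chart_subalg K h n i0.
have I1 : invariants h i0 1 by rewrite -(rmorph1 (fun_cst h n)).
have psi1 : psi 1 = 1 by rewrite -(rmorph1 (fun_cst h n)); apply: psic.
pose V : set FR := [set f | exists m,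
  [/\ invariants h i0 m, psi m != 0 & chart_ring i0 (m * f)]].
have V1 g : chart_ring i0 g -> V g.
  by move=> ig; exists 1; split; rewrite ?psi1 ?oner_neq0 ?mul1r.
suff VP : chart_ring i `<=` V.
  move=> [/VP[m [[im invm] m0 imf]] invf]; exists m; split=> //.
  by split=> //; rewrite rmorphM invm invf.
apply: chart_min => [||a].
- split=> [c|f' g [m [im m0 imf]] [m' [im' m'0 img]]]; first exact/V1.
  have [_ imm'] := IM m m' im im'; have mm'0 : psi (m * m') != 0.
    by have [_ ->] := psiM m m' im im'; rewrite mulf_neq0.
  split; exists (m * m'); split=> //.
    have [_ h1] := CM m' (m * f') im'.1 imf; have [_ h2] := CM m (m' * g) im.1 img.
    have [h3 _] := CM _ _ h1 h2.
    by rewrite mulrDr -[X in X + _]mulrA -[X in _ + X]mulrA [X in X + _]mulrCA.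
  have [_ h3] := CM _ _ imf img.
  by rewrite mulrACA.
- rewrite /base_gen; case: ifP => _; last by apply/V1; exact: (@chart_base_gen K h n i0).
  exists (base_gen h i0); rewrite psi_base /= k0; split=> //.
    by apply: even_gens_invariants; left.
  rewrite [X in X * _]/(fun_emb h n (coordinate K ord0)) emb_mulV ?coordinate_neq0 //.
  exact: I1.1.
- case: (unliftP ord0 a) => [j ->|->].
    rewrite odd_genS /line_gen; case: ifP => _; last first.
      by apply: V1; have := @chart_odd_gen K h n i0 (lift ord0 j);
         rewrite odd_genS /line_gen /= ffunE.
    set z := odd_gen h i0 (lift ord0 j).
    have zz : invariants h i0 (z * z).
      by apply: even_gens_invariants; right; exists (lift ord0 j) => //; exists (lift ord0 j).
    (* The factor z alone would not be invariant. *)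
    exists (z * z); rewrite psi_even /odd_val liftK /= ffunE; split=> //.
      by rewrite !mulf_neq0.
    have -> : z * z * fun_emb h n (coordinate K (lift ord0 j))^-1 = z.
      by rewrite /z odd_genS /line_gen /= ffunE -mulrA emb_mulV ?coordinate_neq0 // mulr1.
    exact: chart_odd_gen.
  rewrite odd_gen0; case: ifP => _; last first.
    by apply: V1; have := @chart_odd_gen K h n i0 ord0; rewrite odd_gen0.
  set x := base_gen h i0.
  have ix : invariants h i0 x by apply: even_gens_invariants; left.
  have xX r : invariants h i0 (x ^+ r) /\ psi (x ^+ r) = k ord0 ^+ r.
    elim: r => [|r [ir IH]]; first by rewrite !expr0.
    rewrite !exprS; have [_ ->] := psiM _ _ ix ir; have [_ ?] := IM _ _ ix ir.
    by rewrite IH psi_base.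
  have [ixG psixG] := xX (genus_succ h).
  exists (x ^+ genus_succ h); rewrite psixG expf_neq0 //; split=> //.
  have -> : x ^+ genus_succ h * (fun_y h n *
    fun_emb h n (coordinate K ord0 ^- genus_succ h)) = fun_y h n.
    have -> : x = fun_emb h n (coordinate K ord0) by [].
    by rewrite -rmorphXn mulrCA emb_mulV ?expf_neq0 ?coordinate_neq0 // mulr1.
  by have := @chart_odd_gen K h n i0 ord0; rewrite odd_gen0.
Qed.

(** The point is constructed on the chart [i0]; numerator and denominator of a fraction from another
    chart are multiplied by a common factor that brings both into [i0]. *)
Lemma param_point : exists Q : Defs.point X (@idfun K), forall i f a b,
  invariants h i a -> invariants h i b -> psi b != 0 -> b * f = a ->
  sval Q f = Some (psi a / psi b).
Proof.
have psiI i : @alg_hom_on K X K idfun (invariants h i) psi.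
  have [psic psiM] := psiP; split=> // a b /invS Sa /invS Sb.
  exact: psiM.
have [Q QE] := @point_of_hom K X K idfun i0 psi (psiI i0).
exists Q => i f a b ia ib b0 ba; apply/QE.
have [m [im m0 ima]] := clear_denominators ia.
have [m' [im' m'0 imb]] := clear_denominators ib.
have psiM a' b' : S a' -> S b' -> psi (a' * b') = psi a' * psi b'.
  by move=> Sa Sb; have [_ ->] := psiP.2 a' b' Sa Sb.
have SM a' b' : S a' -> S b' -> S (a' * b').
  by move=> Sa Sb; have [] := Salg.2 a' b' Sa Sb.
have IM g g' : invariants h i0 g -> invariants h i0 g' -> invariants h i0 (g * g').
  by move=> ig ig'; have [_ IM] := @invariants_subalg K h n i0; have [] := IM g g' ig ig'.
have [Sa Sb] := (invS ia, invS ib); have [Sm Sm'] := (invS im, invS im').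
exists (m' * (m * a)), (m * (m' * b)); split.
- exact: IM.
- exact: IM.
- by rewrite !psiM ?mulf_neq0 //; exact: SM.
- by rewrite -ba -!mulrA mulrCA.
- rewrite !psiM; try exact: SM; try by [].
  by field; rewrite b0 m0 m'0.
Qed.

End ParameterPoint.

(** * Local points and their approximation *)

Section Reciprocal.
Variables (F : fieldType) (N : nat).
Implicit Type p : {poly F}.

(** For [p] of degree at most [N] this is X^N p(1 / X); when the degree is smaller than [N], 0 is a
    root. *)
Definition reciprocal p : {poly F} := \poly_(j < N.+1) p`_(N - j).

Lemma horner_reciprocal p t : (size p <= N.+1)%N -> t != 0 ->
  (reciprocal p).[t^-1] = p.[t] / t ^+ N.
Proof.
move=> sp t0; rewrite /reciprocal horner_poly (horner_coef_wide _ sp) mulr_suml.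
rewrite (reindex_inj rev_ord_inj) /=; apply: eq_bigr => j _.
have jN : (j <= N)%N by rewrite -ltnS.
move: (nat_of_ord j) jN => {}j jN; rewrite subSS subKn // -mulrA; congr (_ * _).
apply: (mulIf (expf_neq0 N t0)); rewrite divfK ?expf_neq0 //.
by rewrite -[in t ^+ N](subnK jN) exprD mulrA exprVn mulVf ?mul1r ?expf_neq0.
Qed.

Lemma horner_X_deriv p m t : (size p <= m)%N ->
  t * p^`().[t] = \sum_(j < m) (p`_j *+ j) * t ^+ j.
Proof.
move=> sp; have -> : t * p^`().[t] = ('X * p^`()).[t] by rewrite hornerM hornerX.
rewrite (@horner_coef_wide _ m); last first.
  apply/leq_sizeP => j mj; rewrite coefXM coef_deriv; case: j mj => //= j mj.
  by rewrite nth_default ?mul0rn // (leq_trans sp).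
by apply: eq_bigr => -[[|j] jm] _; rewrite coefXM /= ?coef_deriv ?mulr0n.
Qed.

(** By the previous lemma, a coefficient counted [j] times in one sum is counted [N - j] times in
    the other, [N] times in all. *)
Lemma reciprocal_deriv p t : (size p <= N.+1)%N -> t != 0 ->
  t * (reciprocal p)^`().[t] + t ^+ N * (t^-1 * p^`().[t^-1]) =
  (reciprocal p).[t] *+ N.
Proof.
move=> sp t0; rewrite (@horner_X_deriv _ N.+1) ?size_poly //.
rewrite (horner_X_deriv _ sp) mulr_sumr /reciprocal horner_poly -sumrMnl.
rewrite [X in _ + X](reindex_inj rev_ord_inj) /= -big_split /=.
apply: eq_bigr => j _; rewrite coef_poly ltn_ord.
have jN : (j <= N)%N by rewrite -ltnS.
move: (nat_of_ord j) jN => {}j jN; rewrite subSS.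
have -> : t ^+ N = t ^+ (N - j) * t ^+ j by rewrite -exprD subnK.
rewrite exprVn -mulrnAl -[X in _ = (_ *+ X) * _](subnKC jN) mulrnDr mulrDl; congr (_ + _).
have := expf_neq0 (N - j) t0; move: (_ *+ _) (t ^+ _) (t ^+ _) => u r s s0.
by field.
Qed.

(* At a nonzero root this follows from differentiating X^N p(1/X); at 0 the
   derivative is the coefficient of X^(N-1) in p. *)
Lemma reciprocal_simple_root p a : separable_poly p -> (N <= size p <= N.+1)%N ->
  (1 < size p)%N -> root (reciprocal p) a -> ~~ root (reciprocal p)^`() a.
Proof.
move=> psep /andP[Np pN] p1 ra.
have [a0|a0] := eqVneq a 0.
  have [m Nm] : exists m, N = m.+1 by case: (N) pN p1 => [|m] *; [lia|exists m].
  have pN0 : p`_N = 0.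
    by move: ra; rewrite rootE a0 horner_coef0 coef_poly /= subn0 => /eqP.
  rewrite rootE a0 horner_coef0 coef_deriv coef_poly Nm /= mulr1n subSS subn0.
  have sp : size p = N.
    apply/eqP; rewrite eqn_leq Np andbT leqNgt; apply/negP => Nsp.
    have e : size p = N.+1 by apply/eqP; rewrite eqn_leq pN.
    have /eqP : lead_coef p = 0 by rewrite lead_coefE e.
    by rewrite lead_coef_eq0 -size_poly_eq0 e.
  have <- : lead_coef p = p`_m by rewrite lead_coefE sp Nm.
  by rewrite lead_coef_eq0 -size_poly_eq0 sp Nm.
have pa : root p a^-1.
  have := horner_reciprocal pN (invr_neq0 a0); rewrite invrK (eqP ra) => /esym/eqP.
  by rewrite mulf_eq0 invr_eq0 expf_eq0 invr_eq0 (negPf a0) andbF orbF.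
have dp : p^`().[a^-1] != 0 by move: psep; rewrite separable_poly.unlock => /coprimep_root/(_ pa).
have := reciprocal_deriv pN a0; rewrite (eqP ra) mul0rn; apply: contra_eqN.
move=> /eqP ->; rewrite mulr0 add0r !mulf_neq0 ?expf_neq0 ?invr_eq0 //.
Qed.

End Reciprocal.

Lemma map_reciprocal (F F' : fieldType) (f : {rmorphism F -> F'}) N p :
  map_poly f (reciprocal N p) = reciprocal N (map_poly f p).
Proof.
apply/polyP => j; rewrite coef_map coef_poly [RHS]coef_poly /=.
by case: ifP => _; rewrite ?rmorph0 // coef_map.
Qed.

(** * Local points of a chart as matrices of rank at most one *)

Section ChartPolynomial.
Variables (K : fieldType) (h : {poly K}) (n : nat).

(** In a chart the curve reads w_0^2 = p(X) with this polynomial p; at infinity, y^2 = h(x) has been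
    divided by x^(2g+2). *)
Definition chart_poly (b : bool) : {poly K} :=
  if b then reciprocal (genus_succ h).*2 h else h.

(** The upper bound makes the reciprocal a true reversal of [h]; the lower one serves to show that a
    root of it at 0 is simple. *)
Lemma size_genus_succ : ((genus_succ h).*2 <= size h <= (genus_succ h).*2.+1)%N.
Proof. by rewrite /genus_succ; lia. Qed.

Lemma fun_y_sq : fun_y h n * fun_y h n =
  fun_emb h n (map_poly (@coord_cst K n) h).[coordinate K ord0].
Proof.
have e : in_qpoly (curve_eqn h n) (curve_eqn h n) = 0.
  apply: val_inj; rewrite /= mk_monic_curve_eqn Pdiv.RingMonic.rmodpp //.
  by rewrite -mk_monic_curve_eqn monic_mk_monic.
apply/eqP; rewrite -subr_eq0 /fun_y /fun_emb /= qpolyC_in_qpoly -expr2 -rmorphXn -rmorphB.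
exact/eqP.
Qed.

Lemma odd_gen_sq (i : bool * {ffun 'I_n -> bool}) :
  odd_gen h i ord0 * odd_gen h i ord0 =
  (map_poly (fun_cst h n) (chart_poly i.1)).[base_gen h i].
Proof.
have mapE p t : (map_poly (fun_cst h n) p).[fun_emb h n t] =
    fun_emb h n (map_poly (@coord_cst K n) p).[t].
  by rewrite -horner_map -map_poly_comp.
rewrite odd_gen0 /base_gen /chart_poly; case: ifP => _; rewrite mapE; last exact: fun_y_sq.
have /andP[_ sh] := size_genus_succ.
rewrite map_reciprocal horner_reciprocal ?size_map_poly ?coordinate_neq0 //.
rewrite mulrACA fun_y_sq -!rmorphM; congr (fun_emb h n (_ * _)).
by rewrite -invfM -exprD addnn.
Qed.

Section HomOnInvariants.
Variables (L : fieldType) (iota : {rmorphism K -> L}).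
Variables (i : bool * {ffun 'I_n -> bool}) (phi : fun_ring h n -> L).
Hypothesis phiP : @alg_hom_on K (curve_times_lines h n) L iota (invariants h i) phi.

Definition base_image : L := phi (base_gen h i).
Definition even_image (a b : 'I_n.+1) : L := phi (odd_gen h i a * odd_gen h i b).

Let evenI a b : invariants h i (odd_gen h i a * odd_gen h i b).
Proof. by apply: even_gens_invariants; right; exists a => //; exists b. Qed.

Lemma even_image_rank1 a b c d :
  even_image a b * even_image c d = even_image a c * even_image b d.
Proof.
have [_ phiM] := phiP.
rewrite /even_image -(phiM _ _ (evenI a b) (evenI c d)).2.
by rewrite -(phiM _ _ (evenI a c) (evenI b d)).2 mulrACA.
Qed.

Lemma hom_horner p g : invariants h i g ->
  invariants h i (map_poly (fun_cst h n) p).[g] /\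
  phi (map_poly (fun_cst h n) p).[g] = (map_poly iota p).[phi g].
Proof.
move=> ig; have [phic phiM] := phiP.
have [Ic IM] := @invariants_subalg K h n i.
elim/poly_ind: p => [|p c [ip IH]].
  rewrite !rmorph0 !horner0 -(rmorph0 (fun_cst h n)); split; first exact: Ic.
  by rewrite phic rmorph0.
have [_ ipg] := IM _ _ ip ig.
rewrite !rmorphD !rmorphM /= !map_polyX !map_polyC /= !hornerMXaddC.
have [ipgc _] := IM _ _ ipg (Ic c); split=> //.
by have [-> _] := phiM _ _ ipg (Ic c); have [_ ->] := phiM _ _ ip ig; rewrite IH phic.
Qed.

Lemma even_image00 :
  even_image ord0 ord0 = (map_poly iota (chart_poly i.1)).[base_image].
Proof.
rewrite /even_image odd_gen_sq; apply: (hom_horner _ _).2.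
by apply: even_gens_invariants; left.
Qed.

(* A symmetric matrix all of whose 2 x 2 minors vanish is d f f^T. *)
Lemma even_image_decomposition : exists d f,
  [/\ d != 0, forall a b, even_image a b = d * f a * f b &
    if even_image ord0 ord0 == 0 then f ord0 = 0 else f ord0 = 1].
Proof.
have diag a : even_image a a != 0 -> forall b c,
    even_image b c = even_image a a * (even_image a b / even_image a a)
      * (even_image a c / even_image a a).
  by move=> a0 b c; apply: (mulfI a0); rewrite even_image_rank1; field.
case: (eqVneq (even_image ord0 ord0) 0) => [Q0|Q0]; last first.
  exists (even_image ord0 ord0), (fun b => even_image ord0 b / even_image ord0 ord0).
  by split=> //; [exact: diag|rewrite divff].
have [[a a0]|nz] := pselect (exists a, even_image a a != 0).
  exists (even_image a a), (fun b => even_image a b / even_image a a); split=> //.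
    exact: diag.
  have /eqP := even_image_rank1 a ord0 a ord0.
  by rewrite Q0 mulr0 mulf_eq0 orbb => /eqP->; rewrite mul0r.
(* All diagonal entries vanish, and each entry squares to a product of two of them, so the matrix is
   0 and any nonzero [d] would do. *)
exists 1, (fun=> 0); split=> //; first exact: oner_neq0.
move=> a b; rewrite mulr0; apply/eqP.
have /eqP aa0 : even_image a a == 0 by apply: contrapT => /negP aa; apply: nz; exists a.
have /eqP := even_image_rank1 a b a b.
by rewrite aa0 mul0r mulf_eq0 orbb.
Qed.

End HomOnInvariants.

(** This is the smoothness of the curve where w_0 = 0. Separability of [h] passes to [L], its
    reciprocal has simple roots too, and the derivative at [a] is [q.[a]]. *)
Lemma chart_poly_simple_root (L : fieldType) (iota : {rmorphism K -> L}) b (a : L) :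
  separable_poly h -> (1 < size h)%N ->
  root (map_poly iota (chart_poly b)) a ->
  exists q, map_poly iota (chart_poly b) = q * ('X - a%:P) /\ q.[a] != 0.
Proof.
move=> hsep h1; set p := map_poly _ _ => ra.
have [q pq] : exists q, p = q * ('X - a%:P) by exact/factor_theorem.
exists q; split=> //.
suff : ~~ root p^`() a.
  rewrite rootE pq derivM derivXsubC hornerD !hornerM hornerXsubC subrr mulr0 add0r.
  by rewrite hornerC mulr1.
have hLsep : separable_poly (map_poly iota h) by rewrite separable_map.
move: ra; rewrite /p /chart_poly; case: b {p pq} => [|ra]; last first.
  by have := hLsep; rewrite separable_poly.unlock => /coprimep_root/(_ ra).
rewrite map_reciprocal => ra.
by apply: (reciprocal_simple_root hLsep _ _ ra); rewrite size_map_poly ?size_genus_succ.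
Qed.

Lemma height_chart_poly (L : fieldType) (iota : {rmorphism K -> L})
    (i : bool * {ffun 'I_n -> bool}) (k : 'I_n.+1 -> L) : k ord0 != 0 ->
  (map_poly iota (chart_poly i.1)).[base_val i k] =
  height iota h k * odd_val iota h i k ord0 ^+ 2.
Proof.
move=> k0; rewrite /chart_poly /base_val /odd_val unlift_none /height.
case: ifP => _; last by rewrite expr1n mulr1.
have /andP[_ sh] := size_genus_succ.
rewrite map_reciprocal horner_reciprocal ?size_map_poly // exprVn -exprM.
by rewrite muln2.
Qed.

(* Rescaling the odd coordinates so that the first one gets its prescribed
   value recovers the parameters from them. *)
Lemma params_exist (L : fieldType) (iota : {rmorphism K -> L})
    (i : bool * {ffun 'I_n -> bool}) (x d : L) (e : 'I_n.+1 -> L) :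
  x != 0 -> d != 0 -> (forall a, e a != 0) ->
  d * e ord0 ^+ 2 = (map_poly iota (chart_poly i.1)).[x] ->
  exists k, [/\ generic iota h k, base_val i k = x & forall a b,
    height iota h k * odd_val iota h i k a * odd_val iota h i k b = d * e a * e b].
Proof.
move=> x0 d0 e0 de.
pose y := if i.1 then x^-1 else x.
have y0 : y != 0 by rewrite /y; case: ifP => _; rewrite ?invr_eq0.
pose o : L := if i.1 then y ^- genus_succ h else 1.
have o0 : o != 0 by rewrite /o; case: ifP => _; rewrite ?oner_neq0 ?invr_eq0 ?expf_neq0.
pose l := o / e ord0; have l0 : l != 0 by rewrite mulf_neq0 ?invr_eq0.
pose D := (map_poly iota h).[y].
(* This inverts [odd_val], whose value for an inverted line coordinate is [(k a * height k)^-1]. *)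
pose k (a : 'I_n.+1) : L := if unlift ord0 a is Some j
  then if i.2 j then (l * e a * D)^-1 else l * e a else y.
have k00 : k ord0 = y by rewrite /k unlift_none.
have hk : height iota h k = D by rewrite /height k00.
have bk : base_val i k = x.
  by rewrite /base_val k00 /y; case: (i.1); rewrite ?invrK.
have ok0 : odd_val iota h i k ord0 = o by rewrite /odd_val unlift_none k00.
have DE : D = d / l ^+ 2.
  have := @height_chart_poly L iota i k.
  rewrite k00 bk -de hk ok0 => /(_ y0) => dE.
  apply: (mulIf (expf_neq0 2 o0)); rewrite -dE /l.
  by field; rewrite e0 o0.
have D0 : D != 0 by rewrite DE mulf_neq0 ?invr_eq0 ?expf_neq0.
have kP : generic iota h k.
  split=> [|a]; first by rewrite hk.
  rewrite /k; case: unliftP => [j _|_] //.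
  by case: ifP => _; rewrite ?invr_eq0 !mulf_neq0 ?invr_eq0.
have ok a : odd_val iota h i k a = l * e a.
  case: (unliftP ord0 a) => [j ->|->]; last by rewrite ok0 divfK.
  rewrite /odd_val liftK hk /k liftK; case: (i.2 j) => //.
  have -> : (l * e (lift ord0 j) * D)^-1 * D = (l * e (lift ord0 j))^-1.
    by rewrite invfM mulfVK.
  exact: invrK.
exists k; split=> // a b; rewrite !ok hk DE.
by field.
Qed.

End ChartPolynomial.

(** * Absolute values induced by the completions *)

Section Places.
Variables (R : realType) (K : fieldType).
Implicit Type v : place R K.

Definition global_abs v (Kv : completion v) : K -> R :=
  @completion_abs _ _ _ Kv \o completion_emb Kv.

Lemma global_absP v (Kv : completion v) : is_absval (global_abs Kv).
Proof. by have [v0 [_ _ E]] := svalP v; have := completion_place Kv; rewrite E => -[]. Qed.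

(** Were it trivial, {0} would be open, also for the representative of the place; but there powers
    of an element of absolute value below 1 come arbitrarily close to 0. *)
Lemma global_abs_nontrivial v (Kv : completion v) : nontrivial_absval (global_abs Kv).
Proof.
have wP := global_absP Kv; set w := global_abs Kv.
have [v0 [v0P v0nt E]] := svalP v; have := completion_place Kv; rewrite E => -[_ st].
apply: contrapT => ntr.
have w1 y : y != 0 -> w y = 1.
  by move=> y0; apply/eqP; apply: contrapT => /negP wy; apply: ntr; exists y.
have op0 : absval_open w [set 0].
  move=> x ->; exists 1 => // y; rewrite subr0 => wy.
  apply/eqP; apply: contraTT wy => y0.
  by rewrite -leNgt w1.
have [e e0 eV] := (st [set 0]).2 op0 0 erefl.
have [a a1] := nontrivial_absval_gt1 v0P v0nt.
have a0 : a != 0 by apply: contraTneq a1 => ->; rewrite absval0 // ltr10.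
have va : v0 a^-1 < 1 by rewrite absvalV // invf_lt1 // absval_gt0.
have [N _ /(_ N (leqnn N))/= aN] := absval_geometric v0P va e0.
by have /eqP := eV _ aN; rewrite expf_eq0 invr_eq0 (negPf a0) andbF.
Qed.

(** This makes the filter of punctured neighbourhoods of 0 proper. *)
Lemma completion_small v (Kv : completion v) e : 0 < e ->
  exists2 y : Kv, y != 0 & @completion_abs _ _ _ Kv y < e.
Proof.
move=> e0; have wP := global_absP Kv.
have [a a1] := nontrivial_absval_gt1 wP (global_abs_nontrivial Kv).
have a0 : a != 0 by apply: contraTneq a1 => ->; rewrite absval0 // ltr10.
have va : global_abs Kv a^-1 < 1 by rewrite absvalV // invf_lt1 // absval_gt0.
have [N _ /(_ N (leqnn N))/=] := absval_geometric wP va e0.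
rewrite subr0 => aN; exists (completion_emb Kv (a^-1 ^+ N)) => //.
by rewrite fmorph_eq0 expf_neq0 // invr_eq0.
Qed.

Lemma global_abs_inequivalent v v' (Kv : completion v) (Kv' : completion v') :
  v <> v' -> ~ same_topology (global_abs Kv) (global_abs Kv').
Proof.
have place_inj (u u' : place R K) : sval u = sval u' -> u = u'.
  by case: u u' => [P p] [P' p'] /=; exact: eq_exist.
move=> vv' st; apply: vv'; apply: place_inj.
have [u [_ _ PE]] := svalP v; have [u' [_ _ PE']] := svalP v'.
have := completion_place Kv; have := completion_place Kv'.
rewrite -[_ \o _]/(global_abs Kv') -[X in sval v X]/(global_abs Kv).
rewrite PE PE' => -[_ st'] [_ st0]; apply/seteqP; split=> x [xP xu]; split=> // U.
  by rewrite -xu st0 st -st'.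
by rewrite -xu st' -st -st0.
Qed.

End Places.

Lemma filter_forall_fin (T : Type) (F : set_system T) (I : finType) (S : I -> set T) :
  Filter F -> (forall i, F (S i)) -> F [set t | forall i, S i t].
Proof.
move=> FF FS; suff : F [set t | forall i, i \in enum I -> S i t].
  by apply: filterS => t St i; apply: St; rewrite mem_enum.
elim: (enum I) => [|i s IH]; first exact: filterE.
apply: filterS (filterI (FS i) IH) => t [Si Ss] j.
by rewrite inE => /predU1P[->|/Ss].
Qed.

(** * Approximation of local points by generic parameters *)

Section LocalApproximation.
Variables (R : realType) (K : fieldType) (v : place R K) (Kv : completion v).
Variables (h : {poly K}) (n : nat).
Hypotheses (h1 : (1 < size h)%N) (hsep : separable_poly h).
Hypothesis two : (2%:R : K) != 0.

Local Notation w := (@completion_abs _ _ _ Kv).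
Local Notation iota := (completion_emb Kv).
Let wP : is_absval w := completion_absP Kv.
Local Notation index := (bool * {ffun 'I_n -> bool})%type.

Definition punctured_nbhs : set_system Kv :=
  [set S | exists2 eta, 0 < eta & forall t, t != 0 -> w t < eta -> S t].

Lemma punctured_nbhs_filter : ProperFilter punctured_nbhs.
Proof.
split.
  by move=> [e e0 eF]; have [y y0 ye] := completion_small Kv e0; exact: eF ye.
split.
- by exists 1.
- move=> S T [e e0 eS] [d d0 dT]; exists (Num.min e d); first by rewrite lt_min e0.
  by move=> t t0; rewrite lt_min => /andP[te td]; split; [apply: eS|apply: dT].
- by move=> S T ST [e e0 eS]; exists e => // t t0 te; apply/ST/eS.
Qed.

#[local] Existing Instance punctured_nbhs_filter.
Let FP : Filter punctured_nbhs := _.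

Lemma punctured_cvg : abs_cvg w punctured_nbhs id 0.
Proof. by move=> e e0; exists e => // t _ te; rewrite /= subr0. Qed.

Lemma punctured_neq0 : punctured_nbhs [set t | t != 0].
Proof. by exists 1. Qed.

Lemma near_add_neq0 l (u : Kv -> Kv) : abs_cvg w punctured_nbhs u 0 ->
  punctured_nbhs [set t | u t != 0] -> punctured_nbhs [set t | l + u t != 0].
Proof.
move=> u0 un; have [->|l0] := eqVneq l 0.
  by apply: filterS un => t /=; rewrite add0r.
apply: (abs_cvg_neq0 wP FP l0).
by rewrite -{2}[l]addr0; apply: (abs_cvgD wP FP) u0; exact: abs_cvg_cst.
Qed.

Section Target.
Variables (i : index) (phi : fun_ring h n -> Kv).
Hypothesis phiP : @alg_hom_on K (curve_times_lines h n) Kv iota (invariants h i) phi.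

(** The matrix and the base coordinate are deformed along [t] so that the base and odd coordinates
    become nonzero while the curve equation is kept. *)
Lemma approximating_family : exists (x d : Kv -> Kv) (e : 'I_n.+1 -> Kv -> Kv) d0 f,
  [/\ d0 != 0 /\ (forall a b, even_image i phi a b = d0 * f a * f b),
      abs_cvg w punctured_nbhs x (base_image i phi) /\ abs_cvg w punctured_nbhs d d0,
      (forall a, abs_cvg w punctured_nbhs (e a) (f a)) &
      punctured_nbhs [set t | [/\ x t != 0, (forall a, e a t != 0) &
        d t * e ord0 t ^+ 2 = (map_poly iota (chart_poly h i.1)).[x t]]]].
Proof.
have [d0 [f [d00 QE f0]]] := even_image_decomposition phiP.
have Q00 := even_image00 phiP; set p := map_poly _ _ in Q00 *.
set X0 := base_image i phi in Q00 *.
have cid := punctured_cvg; have nid := punctured_neq0.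
have ccst l := abs_cvg_cst wP FP l.
case: eqP f0 => [Q0|/eqP Q0] f0; last first.
  (* Here [f ord0 = 1]: the base coordinate moves freely and the curve equation determines [d]. *)
  exists (fun t => X0 + t), (fun t => p.[X0 + t]),
    (fun a t => if a == ord0 then 1 else f a + t), d0, f.
  have cx : abs_cvg w punctured_nbhs (fun t => X0 + t) X0.
    by rewrite -{2}[X0]addr0; exact: (abs_cvgD wP FP (ccst X0) cid).
  split=> //.
  - split=> //; have -> : d0 = p.[X0] by rewrite -Q00 QE f0 !mulr1.
    exact: abs_cvg_horner.
  - move=> a; case: eqP => [->|_]; first by rewrite f0; exact: ccst.
    by rewrite -{2}[f a]addr0; exact: (abs_cvgD wP FP (ccst (f a)) cid).
  have ne : punctured_nbhs [set t | forall a, (if a == ord0 then 1 else f a + t) != 0].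
    apply: filter_forall_fin => a; case: eqP => _.
      by apply: filterE => t; exact: oner_neq0.
    exact: near_add_neq0.
  apply: filterS (filterI (near_add_neq0 X0 cid nid) ne) => t [/= ? ?].
  by split=> //; rewrite ?eqxx /= expr1n mulr1.
have rp : root p X0 by rewrite rootE -Q00 Q0.
have [r [pr r0]] := chart_poly_simple_root hsep h1 rp.
set c := r.[X0] in r0.
(* Since [p.[X0 + u t] = r.[X0 + u t] * u t] and [e ord0 t] will be [t], the curve equation holds
   with [d t = r.[X0 + u t] * (d0 / c)], which tends to [d0]. *)
pose u t := d0 / c * t ^+ 2.
have cu : abs_cvg w punctured_nbhs u 0.
  have -> : 0 = d0 / c * 0 ^+ 2 :> Kv by rewrite expr0n mulr0.
  by apply: (abs_cvgM wP FP (ccst _)); exact: abs_cvgX.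
have nu : punctured_nbhs [set t | u t != 0].
  by apply: filterS nid => t /= t0; rewrite mulf_neq0 ?expf_neq0 // mulf_neq0 ?invr_eq0.
have cx : abs_cvg w punctured_nbhs (fun t => X0 + u t) X0.
  by rewrite -{2}[X0]addr0; exact: (abs_cvgD wP FP (ccst X0) cu).
exists (fun t => X0 + u t), (fun t => r.[X0 + u t] * (d0 / c)), (fun a t => f a + t), d0, f.
split=> //.
- split=> //; rewrite -[X in abs_cvg _ _ _ X](_ : c * (d0 / c) = d0); last first.
    by rewrite mulrCA divff // mulr1.
  by apply: (abs_cvgM wP FP) (ccst _); exact: abs_cvg_horner.
- by move=> a; rewrite -{2}[f a]addr0; exact: (abs_cvgD wP FP (ccst (f a)) cid).
have ne : punctured_nbhs [set t | forall a, f a + t != 0].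
  by apply: filter_forall_fin => a; exact: near_add_neq0.
apply: filterS (filterI (near_add_neq0 X0 cu nu) ne) => t [/= ? ?].
split=> //; rewrite ?/p pr hornerM hornerXsubC f0 add0r -mulrA -/(u t).
by rewrite [X0 + u t - X0]addrAC subrr add0r.
Qed.

Lemma generic_approximation eta : 0 < eta -> exists q : 'I_n.+1 -> Kv,
  [/\ generic iota h q, w (base_val i q - base_image i phi) < eta &
    forall a b, w (height iota h q * odd_val iota h i q a * odd_val iota h i q b
                   - even_image i phi a b) < eta].
Proof.
move=> eta0; have [x [d [e [d0 [f [[d00 QE] [cx cd] ce ne]]]]]] := approximating_family.
have nQ : punctured_nbhs [set t | forall a b,
    w (d t * e a t * e b t - even_image i phi a b) < eta].
  apply: filter_forall_fin => a; apply: filter_forall_fin => b; rewrite QE.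
  exact: (abs_cvgM wP FP (abs_cvgM wP FP cd (ce a)) (ce b)).
have nd := abs_cvg_neq0 wP FP d00 cd.
have [t [[x0 e0 de] [dt0 [xt Qt]]]] :=
  filter_ex (filterI ne (filterI nd (filterI (cx _ eta0) nQ))).
have [q [qP qx qQ]] := params_exist x0 dt0 e0 de.
by exists q; split=> // [|a b]; rewrite ?qx ?qQ.
Qed.

End Target.

Section Continuity.
Variables (i : index) (q : 'I_n.+1 -> Kv).
Hypothesis qP : generic iota h q.

Definition param_nbhs : set_system ('I_n.+1 -> K) :=
  [set S | exists2 eta, 0 < eta & forall k, (forall a, w (iota (k a) - q a) < eta) -> S k].

Lemma param_nbhs_filter : Filter param_nbhs.
Proof.
split.
- by exists 1.
- move=> S T [e e0 eS] [d d0 dT]; exists (Num.min e d); first by rewrite lt_min e0.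
  by move=> k kq; split; [apply: eS|apply: dT] => a;
    have := kq a; rewrite lt_min => /andP[].
- by move=> S T ST [e e0 eS]; exists e => // k kq; apply/ST/eS.
Qed.

#[local] Existing Instance param_nbhs_filter.
Let FN := param_nbhs_filter.

Lemma param_cvg a : abs_cvg w param_nbhs (fun k => iota (k a)) (q a).
Proof. by move=> e e0; exists e => // k; apply. Qed.

Lemma height_cvg :
  abs_cvg w param_nbhs (fun k => iota (height idfun h k)) (height iota h q).
Proof.
have := abs_cvg_horner wP FN (map_poly iota h) (param_cvg ord0).
by apply: (abs_cvg_ext FN) => k; rewrite /height map_poly_id // horner_map.
Qed.

Lemma base_val_cvg : abs_cvg w param_nbhs (fun k => iota (base_val i k)) (base_val i q).
Proof.
have [_ q0] := qP; rewrite /base_val; case: ifP => _; last exact: param_cvg.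
apply: (abs_cvg_ext FN) (abs_cvgV wP FN (q0 ord0) (param_cvg ord0)) => k.
by rewrite fmorphV.
Qed.

Lemma odd_val_cvg a : abs_cvg w param_nbhs (fun k => iota (odd_val idfun h i k a))
  (odd_val iota h i q a).
Proof.
have [d0 q0] := qP; rewrite /odd_val; case: unliftP => [j _|_].
  case: ifP => _; last exact: param_cvg.
  have qd0 : q a * height iota h q != 0 by rewrite mulf_neq0.
  apply: (abs_cvg_ext FN) (abs_cvgV wP FN qd0 (abs_cvgM wP FN (param_cvg a) height_cvg)) => k.
  by rewrite fmorphV rmorphM.
case: ifP => _.
  apply: (abs_cvg_ext FN) (abs_cvgV wP FN (expf_neq0 _ (q0 ord0))
    (abs_cvgX wP FN (genus_succ h) (param_cvg ord0))) => k.
  by rewrite fmorphV rmorphXn.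
by apply: (abs_cvg_ext FN) (abs_cvg_cst wP FN 1) => k; rewrite rmorph1.
Qed.

Lemma generic_near : param_nbhs [set k | generic idfun h k].
Proof.
have [d0 q0] := qP.
have nq : param_nbhs [set k | forall a, iota (k a) != 0].
  by apply: filter_forall_fin => a; exact: abs_cvg_neq0 (param_cvg a).
apply: filterS (filterI nq (abs_cvg_neq0 wP FN d0 height_cvg)) => k [/= k0 dk0].
split=> [|a]; first by rewrite fmorph_eq0 in dk0.
by have := k0 a; rewrite fmorph_eq0.
Qed.

End Continuity.

Local Notation X := (@quotient K (curve_times_lines h n) (fun_inv h n)).

(** A neighbourhood of [P], which need not have parameters itself, is replaced by a polydisc around
    generic parameters [q]. As [psi] and [Q] are arbitrary, one choice of [psi] over [K] can serve
    all places. *)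
Lemma local_approximation (P : local_point X Kv) (U : set (local_point X Kv)) :
  nbhs P U -> exists (q : 'I_n.+1 -> Kv) theta, 0 < theta /\
  forall k : 'I_n.+1 -> K, (forall a, w (iota (k a) - q a) < theta) ->
    generic idfun h k /\
    forall psi : fun_ring h n -> K,
      (forall i, @alg_hom_on K (curve_times_lines h n) K idfun (invariants h i) psi) ->
      (forall i, psi (base_gen h i) = base_val i k) ->
      (forall i a b, psi (odd_gen h i a * odd_gen h i b) =
         height idfun h k * odd_val idfun h i k a * odd_val idfun h i k b) ->
    forall Q : local_point X Kv,
      (forall i f a b, invariants h i a -> invariants h i b -> psi b != 0 -> b * f = a ->
         sval Q f = Some (iota (psi a / psi b))) -> U Q.
Proof.
move=> PU; have [i [phi [phiP PE]]] := svalP P.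
have phiP' : @alg_hom_on K (curve_times_lines h n) Kv iota (invariants h i) phi := phiP.
have gen (S : set (fun_ring h n)) : (forall c, S (fun_cst h n c)) ->
  (forall a b, invariants h i a -> invariants h i b -> S a -> S b -> S (a + b) /\ S (a * b)) ->
  even_gens h i `<=` S -> invariants h i `<=` S.
  move=> Sc SD GS; have [Ic ID] := @invariants_subalg K h n i.
  suff : invariants h i `<=` S `&` invariants h i by move=> H f /H[].
  apply: invariants_min => //.
    split=> [c|a b [Sa Ia] [Sb Ib]]; first by split.
    have [? ?] := SD a b Ia Ib Sa Sb; have [? ?] := ID a b Ia Ib.
    by split; split.
  by move=> g Gg; split; [exact: GS|exact: even_gens_invariants].
have [eta eta0 etaP] := @nbhs_hom R K X v Kv (invariants h i) (even_gens h i)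
  phi phiP' gen P U PE PU.
have [q [qP qx qQ]] := generic_approximation phiP' eta0.
have FN := param_nbhs_filter q.
have ccst l := abs_cvg_cst wP FN l.
have nx : param_nbhs q [set k | w (iota (base_val i k) - base_image i phi) < eta].
  exact: (abs_cvg_lt wP FN (abs_cvgD wP FN (base_val_cvg i qP) (ccst _)) qx).
have nQ : param_nbhs q [set k | forall a b,
    w (iota (height idfun h k * odd_val idfun h i k a * odd_val idfun h i k b)
       - even_image i phi a b) < eta].
  apply: filter_forall_fin => a; apply: filter_forall_fin => b.
  apply: (abs_cvg_lt wP FN _ (qQ a b)); apply: (abs_cvgD wP FN) (ccst _).
  have := abs_cvgM wP FN (abs_cvgM wP FN (height_cvg q) (odd_val_cvg i qP a)) (odd_val_cvg i qP b).
  by apply: (abs_cvg_ext FN) => k; rewrite !rmorphM.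
have [theta theta0 thetaP] := filterI (generic_near qP) (filterI nx nQ).
exists q, theta; split=> // k kq; have [kP [kx kQ]] := thetaP k kq.
split=> // psi psiP psi_base psi_even Q QE.
apply: (etaP (iota \o psi)) => [|g [->|[a _ [b _ <-]]]|f a b ia ib b0 ba] /=.
- have [psic psiD] := psiP i; split=> [c|a b ia ib]; first by rewrite /= psic.
  by have [DE ME] := psiD a b ia ib; rewrite /= DE ME rmorphD rmorphM.
- by rewrite psi_base.
- by rewrite psi_even.
- have pb : psi b != 0 by move: b0; rewrite /= fmorph_eq0.
  by rewrite -fmorph_div; exact: (QE i f a b ia ib pb ba).
Qed.

End LocalApproximation.

(** * From finitely many places to a global point *)

Lemma generic_params_exist (K : fieldExtType rat) (h : {poly K}) n :
  (0 < size h)%N -> exists k : 'I_n.+1 -> K, generic idfun h k.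
Proof.
move=> h0; have hX : 'X * h != 0.
  by rewrite mulf_neq0 ?polyX_eq0 // -size_poly_gt0.
pose s : seq K := [seq m%:R | m <- iota 1 (size ('X * h))].
have us : uniq s.
  rewrite map_inj_uniq ?iota_uniq // => m m' /eqP.
  rewrite -!(rmorph_nat (in_alg K)) (inj_eq (fmorph_inj _)) eqr_nat.
  by move/eqP.
(* The nonzero polynomial ['X * h] has fewer roots than its size, which is the number of distinct
   elements of [s]. *)
have [x xs xh] : exists2 x, x \in s & ~~ root ('X * h) x.
  apply/hasP; rewrite has_predC; apply/negP => rs.
  by have := max_poly_roots hX rs us; rewrite size_map size_iota ltnn.
move: xh; rewrite rootM negb_or rootX => /andP[x0 hx].
by exists (fun=> x); split=> //; rewrite /height map_poly_id.
Qed.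

Theorem corollary2p14 (R : realType) (K : fieldExtType rat) (h : {poly K})
    (h_degree : (5 < size h)%N) (h_separable : separable_poly h)
    (n : nat) (n_cases : n = 1%N \/ n = 2%N) :
  weak_approximation R (@quotient K (curve_times_lines h n) (fun_inv h n)).
Proof.
move=> Kv O [P OP] oO.
have two : (2%:R : K) != 0.
  by rewrite -(rmorph_nat (in_alg K)) fmorph_eq0.
have h1 : (1 < size h)%N by apply: leq_trans h_degree.
have [l [U [PU UO]]] := nbhs_prod_topology (open_nbhs_nbhs (conj oO OP)).
pose approx v := cid (local_approximation h1 h_separable two (PU v)).
pose q v := sval (approx v); pose approx_theta v := cid (svalP (approx v)).
pose theta v := sval (approx_theta v); have thetaP v := svalP (approx_theta v).
have theta0 v : 0 < theta v := (thetaP v).1.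
(* By density of [K] in the completions the local targets are replaced by elements of [K]; the other
   half of [theta] is left for Artin-Whaples. *)
have /choice[t tP] : forall va : place R K * 'I_n.+1, exists t : K,
    @completion_abs _ _ _ (Kv va.1) (completion_emb (Kv va.1) t - q va.1 va.2) < theta va.1 / 2.
  by move=> [v a]; apply: completion_dense; rewrite divr_gt0.
(* Artin-Whaples is applied to one parameter at a time, over the places of [l] without
   repetition. *)
have /choice[k kP] : forall a, exists y : K, forall v : {classic place R K},
    v \in undup l -> global_abs (Kv v) (y - t (v, a)) < theta v / 2.
  move=> a; apply: (@artin_whaples R K {classic place R K} (fun v => global_abs (Kv v))).
  - by move=> v; exact: global_absP.
  - by move=> v; exact: global_abs_nontrivial.
  - by move=> v v' /eqP vv'; exact: global_abs_inequivalent.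
  - exact: undup_uniq.
  - by move=> v; rewrite divr_gt0.
have near v : (v : {classic place R K}) \in l -> forall a,
    @completion_abs _ _ _ (Kv v) (completion_emb (Kv v) (k a) - q v a) < theta v.
  move=> vl a; have wP := completion_absP (Kv v).
  have h2 := kP a v; rewrite mem_undup in h2; have {h2} := h2 vl.
  rewrite /global_abs /= rmorphB => h2; have h3 := tP (v, a).
  rewrite -(subrK (completion_emb (Kv v) (t (v, a))) (completion_emb (Kv v) (k a))) -addrA.
  by rewrite (le_lt_trans (absvalD wP _ _)) // (splitr (theta v)) ltrD.
(* Closeness at any place of [l] gives genericity. When [l] is empty there is no such place, and any
   generic parameters serve. *)
have [k' [kP' nearP]] : exists k' : 'I_n.+1 -> K, generic idfun h k' /\
    forall v, (v : {classic place R K}) \in l -> forall a,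
    @completion_abs _ _ _ (Kv v) (completion_emb (Kv v) (k' a) - q v a) < theta v.
  case: (l) near => [|v s] near; last first.
    by exists k; split=> //; exact: ((thetaP v).2 k (near v (mem_head _ _))).1.
  have [k' k'P] := generic_params_exist n (ltnW h1).
  by exists k'.
have [psi [S [[Salg invS] psiP psi_base psi_even]]] := param_hom_exists kP' two.
have psiI i : @alg_hom_on K (curve_times_lines h n) K idfun (invariants h i) psi.
  have [psic psiM] := psiP; split=> // a b /invS Sa /invS Sb.
  exact: psiM.
have [Q QE] := param_point kP' Salg invS psiP psi_base psi_even.
(* [Q] gives a local point at every place; the neighbourhood constrains only those of [l]. *)
pose image v := cid (local_point_of_point (Kv v) Q).
pose Q' v := sval (image v); have Q'E v := svalP (image v).
exists Q'; split; last by exists Q.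
apply: UO => v vl; have [_ UQ] := (thetaP v).2 k' (nearP v vl).
apply: UQ psiI psi_base psi_even (Q' v) _ => i f a b ia ib b0 ba.
by rewrite /Q' Q'E (QE i f a b).
Qed.
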